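(* Let $\mathcal{A}$ be a central arrangement in $V=\mathbb{K}^3$ and $H\in\mathcal{A}$. Let $\chi_0(\mathcal{A},t)=\chi(\mathcal{A},t)/(t-1)$ be the reduced characteristic polynomial, let $(d_2',d_3')$ be the multiexponents of the restricted multiarrangement $(\mathcal{A}^H,\mathbf{k})$ (which is always free), and let $M^1$ be the image of $\mathbf{res}_H^1:\Omega^1(\mathcal{A})\to\Omega^1(\mathcal{A}^H,\mathbf{k})$. Then $\Omega^1(\mathcal{A}^H,\mathbf{k})/M^1$ is finite-dimensional over $\mathbb{K}$ and $$\dim_\mathbb{K}\bigl(\Omega^1(\mathcal{A}^H,\mathbf{k})/M^1\bigr)=\chi_0(\mathcal{A},0)-d_2'd_3'.$$
   Context: $\mathbb{K}$ a field of characteristic $0$, $S=\mathbb{K}[V^*]$. For $H'\in\mathcal{A}$ fix a defining linear form $\alpha_{H'}$. The characteristic polynomial is $\chi(\mathcal{A},t)=\sum_{X\in L_\mathcal{A}}\mu(X)t^{\dim X}$, where $L_\mathcal{A}$ is the set of intersections of elements of $\mathcal{A}$ (including $V$) ordered by reverse inclusion and $\mu$ is its Möbius function ($\mu(V)=1$, $\mu(X)=-\sum_{Y<X}\mu(Y)$). For a multiarrangement $(\mathcal{B},\mathbf{k})$: $D(\mathcal{B},\mathbf{k})=\{\delta\in\mathrm{Der}:\delta(\alpha_{H'})\in\alpha_{H'}^{\mathbf{k}(H')}S\}$, $\Omega^p(\mathcal{B},\mathbf{k})=\{\omega\in\frac{1}{Q}\Omega^p: Q\frac{d\alpha_{H'}}{\alpha_{H'}^{\mathbf{k}(H')}}\wedge\omega\in\Omega^{p+1}\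 \forall H'\}$ with $Q=\prod\alpha_{H'}^{\mathbf{k}(H')}$; $\Omega^p(\mathcal{A})$ is the case $\mathbf{k}\equiv1$. Multiexponents are the degrees of a homogeneous basis of the free module $D$. The restriction $(\mathcal{A}^H,\mathbf{k})$: hyperplanes $H'\cap H$ of $H$ for $H'\in\mathcal{A}\setminus\{H\}$, with $\mathbf{k}(X)=\#\{H'\in\mathcal{A}\setminus\{H\}:H'\cap H=X\}$. In coordinates with $H=\{z_1=0\}$, each $\omega\in\Omega^1(\mathcal{A})$ is uniquely $\omega_1+\frac{dz_1}{z_1}\omega_2$ with $\omega_1$ involving only $dz_2,dz_3$, and $\mathbf{res}^1_H(\omega)=\omega_1|_H\in\Omega^1(\mathcal{A}^H,\mathbf{k})$. *)

(* Defs.v *)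
From HB Require Import structures.
From mathcomp Require Import all_boot all_algebra.
From mathcomp Require Import mpoly.
Set Implicit Arguments. Unset Strict Implicit. Unset Printing Implicit Defensive.
Import GRing.Theory.
Local Open Scope ring_scope.

Section Arr.
Variable K : fieldType.

(* S = K[V^*] = K[z1,z2,z3] (variables 'X_0,'X_1,'X_2);
   S_H = K[H^*] = K[z2,z3] (variables 'X_0,'X_1 of {mpoly K[2]}) *)
Notation S3 := {mpoly K[3]}.
Notation S2 := {mpoly K[2]}.

Definition pdvd {n : nat} (a b : {mpoly K[n]}) : Prop := exists c, b = a * c.

Definition linform (a : 'rV[K]_3) : S3 := \sum_(j < 3) a 0 j *: 'X_j.

(* coefficients of the restriction to H = {z1 = 0} (coordinates z2, z3) *)
Definition resvec (a : 'rV[K]_3) : 'rV[K]_2 := \row_(j < 2) a 0 (lift ord0 j).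
Definition resform (a : 'rV[K]_3) : S2 := \sum_(j < 2) resvec a 0 j *: 'X_j.

Definition rho (p : S3) : S2 := p \mPo [tuple 0; 'X_ord0; 'X_(@ord_max 1)].

Variable n : nat.

(* A central arrangement of n distinct hyperplanes in K^3, the i-th hyperplane
   being the kernel of the (nonzero) linear form with coefficients row i A. *)
Definition arrangement (A : 'M[K]_(n, 3)) : Prop :=
  (forall i, row i A != 0) /\
  (forall i j, i != j -> ~~ (row i A <= row j A)%MS).

(* An element X of L_A is encoded by the set of hyperplanes containing it
   (a "closed" set of indices);  X <= Y in L_A  iff  that set grows.          *)
Definition rowsF (A : 'M[K]_(n, 3)) (F : {set 'I_n}) : 'M[K]_(n, 3) :=
  \matrix_(i, j) (if i \in F then A i j else 0).
Definition closedF (A : 'M[K]_(n, 3)) (F : {set 'I_n}) : bool :=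
  [forall i, (row i A <= rowsF A F)%MS ==> (i \in F)].
Definition dimF (A : 'M[K]_(n, 3)) (F : {set 'I_n}) : nat :=
  (3 - \rank (rowsF A F))%N.

Fixpoint mu_fuel (A : 'M[K]_(n, 3)) (k : nat) (F : {set 'I_n}) : int :=
  match k with
  | O => 1
  | k'.+1 => if F == set0 then 1 else
      - \sum_(G : {set 'I_n} | closedF A G && (G \proper F)) mu_fuel A k' G
  end.
Definition mobius (A : 'M[K]_(n, 3)) (F : {set 'I_n}) : int := mu_fuel A #|F| F.

Definition charpoly (A : 'M[K]_(n, 3)) : {poly int} :=
  \sum_(F : {set 'I_n} | closedF A F) mobius A F *: 'X^(dimF A F).
Definition charpoly0 (A : 'M[K]_(n, 3)) : {poly int} := charpoly A %/ ('X - 1).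

(* omega in (1/Q) Omega^1 is written omega = p/Q with p = sum_j p_j dz_j
   polynomial; then Q (d alpha_i / alpha_i) /\ omega = (d alpha_i /\ p)/alpha_i,
   whose dz_j /\ dz_k coefficient is (a_j p_k - a_k p_j)/alpha_i.             *)
Definition OmegaA (A : 'M[K]_(n, 3)) (p : 'rV[S3]_3) : Prop :=
  forall i (j k : 'I_3),
    pdvd (linform (row i A)) ((A i j)%:MP * p 0 k - (A i k)%:MP * p 0 j).

(* for i <> h, X_i = H_i \cap H has defining form resform (row i A) and
   multiplicity k(X_i) = #{ j <> h : H_j \cap H = X_i } *)
Definition kmult (A : 'M[K]_(n, 3)) (h i : 'I_n) : nat :=
  #|[set j | (j != h) && (resvec (row j A) <= resvec (row i A))%MS
             && (resvec (row i A) <= resvec (row j A))%MS]|.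

(* omega in (1/Q_H) Omega^1_H written as q/Q_H, Q_H = prod_{i<>h} alpha_i|_H
   (a nonzero scalar multiple of prod_X alpha_X^{k(X)}); condition:
   Q dalpha_X / alpha_X^{k(X)} /\ omega in Omega^2  <=>
   alpha_X^{k(X)} divides the coefficient of d alpha_X /\ q. *)
Definition OmegaH (A : 'M[K]_(n, 3)) (h : 'I_n) (q : 'rV[S2]_2) : Prop :=
  forall i, i != h -> forall j k : 'I_2,
    pdvd (resform (row i A) ^+ kmult A h i)
         ((resvec (row i A) 0 j)%:MP * q 0 k - (resvec (row i A) 0 k)%:MP * q 0 j).

(* M^1 = image of res_H^1 : for omega = p/Q in Omega^1(A) (Q = z1 Q'),
   omega_1 = (p_2 dz_2 + p_3 dz_3)/Q = (r_2 dz_2 + r_3 dz_3)/Q' with p_j = z1 r_j,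
   and omega_1|_H = (rho r_2 dz_2 + rho r_3 dz_3)/Q_H  since rho Q' = Q_H. *)
Definition InM (A : 'M[K]_(n, 3)) (q : 'rV[S2]_2) : Prop :=
  exists p : 'rV[S3]_3, OmegaA A p /\
  exists r : 'rV[S3]_2,
    (forall j : 'I_2, p 0 (lift ord0 j) = 'X_ord0 * r 0 j) /\
    q = map_mx rho r.

Definition quot_dim (A : 'M[K]_(n, 3)) (h : 'I_n) (d : nat) : Prop :=
  exists w : 'I_d -> 'rV[S2]_2,
    (forall l, OmegaH A h (w l)) /\
    (forall q, OmegaH A h q ->
       exists c : 'I_d -> K, InM A (q - \sum_(l < d) (c l)%:MP *: w l)) /\
    (forall c : 'I_d -> K, InM A (\sum_(l < d) (c l)%:MP *: w l) ->
       forall l, c l = 0).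

(* logarithmic derivations D(A^H,k): delta = g_2 d/dz_2 + g_3 d/dz_3 *)
Definition DH (A : 'M[K]_(n, 3)) (h : 'I_n) (g : 'rV[S2]_2) : Prop :=
  forall i, i != h ->
    pdvd (resform (row i A) ^+ kmult A h i)
         (\sum_(j < 2) (resvec (row i A) 0 j)%:MP * g 0 j).

Definition DH_basis (A : 'M[K]_(n, 3)) (h : 'I_n) (th : 'I_2 -> 'rV[S2]_2) : Prop :=
  (forall l, DH A h (th l)) /\
  (forall g, DH A h g -> exists f : 'I_2 -> S2, g = \sum_(l < 2) f l *: th l) /\
  (forall f : 'I_2 -> S2, \sum_(l < 2) f l *: th l = 0 -> forall l, f l = 0).

Definition multiexponents (A : 'M[K]_(n, 3)) (h : 'I_n) (d2 d3 : nat) : Prop :=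
  exists th : 'I_2 -> 'rV[S2]_2, DH_basis A h th /\
    (forall j, th ord0 0 j \is d2.-homog) /\
    (forall j, th (@ord_max 1) 0 j \is d3.-homog).

End Arr.

(* Main.v *)
Require Import Defs.
From Stdlib Require Import Classical.
From HB Require Import structures.
From mathcomp Require Import all_boot all_algebra.
From mathcomp Require Import mpoly.
From mathcomp Require Import ring zify.
Set Implicit Arguments. Unset Strict Implicit. Unset Printing Implicit Defensive.
Import GRing.Theory.
Local Open Scope ring_scope.

(** Rotating a 1-form [q_2 dz_2 + q_3 dz_3] into [q_3 d/dz_2 - q_2 d/dz_3]
    identifies [Omega^1(A^H, k)] with [D(A^H, k)], and [M^1] with the
    restriction to [H] of the module [D_H] of logarithmic derivations of [A]
    killing [z_1].  Multiplication by [z_1] is injective modulo [D_H], so that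
    in degree [N] the codimension of [D_H] is the sum over [j <= N] of the
    codimensions of [M^1] in degree [j]; comparing it with the codimensions of
    the free module [D(A^H, k)] gives the dimension of the quotient as soon as
    the codimension of [D_H] is known in all large degrees.

    The latter is computed by adding the lines one at a time.  When a line [l]
    is added to a set [J] of lines, the values [delta(alpha_l)] modulo
    [alpha_l], for [delta] logarithmic along [J], are in large degrees exactly
    the multiples of the product of all lines of [J] but one for each affine
    point of [l] (affine means: not on [H]).  One inclusion follows by
    subtracting a multiple of the Euler field of the point, the other by
    Lagrange interpolation on [l].  Each line thus contributes the number of
    its affine points on previous lines, and these numbers add up to
    [chi_0(A, 0)].  Freeness of [D(A^H, k)] follows in the same way, by raising
    one multiplicity at a time. *)

(** * Relative dimension *)

Section Codim.
Variable K : fieldType.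
Implicit Types V : lmodType K.

(** The count behind the formula: put m = n - 1. A line added to x earlier ones costs N + 1 - x + s
    in degree N, where s is the number of its affine points on them, so D_H has codimension m (N +
    1) - m (m - 1) / 2 + (sum of the s). A free module with exponents d2, d3 has codimension min(j +
    1, d2) + min(j + 1, d3) in degree j, and these add up over j <= N to (d2 + d3)(N + 1) - d2 (d2 -
    1) / 2 - d3 (d3 - 1) / 2 once N is large. Since d2 + d3 = m, the terms in N cancel and m^2 -
    d2^2 - d3^2 = 2 d2 d3 leaves (sum of the s) - d2 d3. The increment from degree N to N + 1 is m
    on both sides, so M^1 is everything in degrees above n; this is the finiteness of the quotient.
    The sum of the s is chi_0(A, 0) because a point with k lines through it is met k - 1 times when
    the lines are added in order, and k - 1 is the Moebius value of the point; the points on H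
    account for the n - 1 that division by t - 1 removes. *)

Definition subsp V (U : V -> Prop) : Prop :=
  U 0 /\ forall (c : K) u v, U u -> U v -> U (c *: u + v).

Lemma subspD V (U : V -> Prop) u v : subsp U -> U u -> U v -> U (u + v).
Proof. by case=> _ H Uu Uv; rewrite -[u]scale1r; apply: H. Qed.

Lemma subspZ V (U : V -> Prop) c u : subsp U -> U u -> U (c *: u).
Proof. by case=> U0 H Uu; rewrite -[_ *: _]addr0; apply: H. Qed.

Lemma subspN V (U : V -> Prop) u : subsp U -> U u -> U (- u).
Proof. by move=> sU Uu; rewrite -scaleN1r; apply: subspZ. Qed.

Lemma subspB V (U : V -> Prop) u v : subsp U -> U u -> U v -> U (u - v).
Proof. by move=> sU Uu Uv; apply: subspD => //; apply: subspN. Qed.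

Lemma subspBK V (U : V -> Prop) u v : subsp U -> U (u - v) -> (U u <-> U v).
Proof.
move=> sU Uuv; split=> H.
  by rewrite -[v](subKr u); apply: subspB.
by rewrite -[u](subrK v); apply: subspD.
Qed.

Lemma subsp_sum V (U : V -> Prop) (I : Type) (r : seq I) (P : pred I) (F : I -> V) :
  subsp U -> (forall i, P i -> U (F i)) -> U (\sum_(i <- r | P i) F i).
Proof.
move=> sU UF; elim/big_ind: _ => //; first by case: sU.
by move=> x y; apply: subspD.
Qed.

Lemma subspI V (U W : V -> Prop) : subsp U -> subsp W -> subsp (fun u => U u /\ W u).
Proof.
case=> U0 HU [W0 HW]; split=> // c u v [Uu Wu] [Uv Wv].
by split; [apply: HU | apply: HW].
Qed.

Definition lincomb V d (w : 'I_d -> V) (c : 'rV[K]_d) : V := \sum_i c 0 i *: w i.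

Lemma lincomb_linear V d (w : 'I_d -> V) a c c' :
  lincomb w (a *: c + c') = a *: lincomb w c + lincomb w c'.
Proof.
rewrite /lincomb scaler_sumr -big_split /=; apply: eq_bigr => i _.
by rewrite !mxE scalerDl scalerA.
Qed.

Lemma lincomb0 V d (w : 'I_d -> V) : lincomb w 0 = 0.
Proof. by rewrite /lincomb big1 // => i _; rewrite mxE scale0r. Qed.

Lemma lincombB V d (w : 'I_d -> V) c c' :
  lincomb w (c - c') = lincomb w c - lincomb w c'.
Proof.
have -> : c - c' = (-1) *: c' + c by rewrite scaleN1r addrC.
by rewrite lincomb_linear scaleN1r addrC.
Qed.

Lemma lincomb_mul V d e (w : 'I_d -> V) (M : 'M[K]_(e, d)) c :
  lincomb (fun i => lincomb w (row i M)) c = lincomb w (c *m M).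
Proof.
rewrite /lincomb; under eq_bigr => i _ do rewrite scaler_sumr.
rewrite exchange_big /=; apply: eq_bigr => j _; rewrite mxE scaler_suml.
by apply: eq_bigr => i _; rewrite mxE scalerA.
Qed.

Lemma subsp_lincomb V (U : V -> Prop) d (w : 'I_d -> V) c :
  subsp U -> (forall i, U (w i)) -> U (lincomb w c).
Proof. by move=> sU Uw; apply: subsp_sum => // i _; apply: subspZ. Qed.

(** The dimension of U modulo its intersection with W, witnessed by a basis. No quotient space is
    formed, so U and W may be arbitrary predicates on an infinite-dimensional module. *)
Definition codim V (U W : V -> Prop) (d : nat) : Prop :=
  exists w : 'I_d -> V, [/\ forall i, U (w i),
    forall u, U u -> exists c, W (u - lincomb w c) &
    forall c, W (lincomb w c) -> c = 0].

Lemma codim_trans V (U U' W : V -> Prop) a b :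
  subsp U -> subsp U' -> subsp W ->
  (forall u, U' u -> U u) -> (forall u, W u -> U' u) ->
  codim U U' a -> codim U' W b -> codim U W (a + b).
Proof.
move=> sU sU' sW U'U WU' [w [Uw spw frw]] [w' [Uw' spw' frw']].
pose v i := match split i with inl j => w j | inr j => w' j end.
have vE c : lincomb v c = lincomb w (lsubmx c) + lincomb w' (rsubmx c).
  rewrite /lincomb big_split_ord /=; congr (_ + _); apply: eq_bigr => i _.
    by rewrite /v mxE (unsplitK (inl i)).
  by rewrite /v mxE (unsplitK (inr i)).
exists v; split.
- by move=> i; rewrite /v; case: split => // j; apply: U'U.
- move=> u /spw [c /spw' [c']]; rewrite -addrA -opprD => H.
  by exists (row_mx c c'); rewrite vE row_mxKl row_mxKr.
move=> c; rewrite vE => Wc.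
have cl : lsubmx c = 0.
  apply: frw; rewrite -[X in U' X](addrK (lincomb w' (rsubmx c))).
  by apply: subspB => //; [apply: WU' | apply: subsp_lincomb].
move: Wc; rewrite cl lincomb0 add0r => /frw' cr.
by rewrite -[c]hsubmxK cl cr row_mx0.
Qed.

(* A linear relation, total on both sides and compatible with [W] and [W'],
   induces an isomorphism of [U / W] with [U' / W']. *)
Lemma codim_rel V V' (U W : V -> Prop) (U' W' : V' -> Prop)
    (R : V -> V' -> Prop) d :
  subsp U -> subsp U' ->
  R 0 0 ->
  (forall c u v u' v', R u u' -> R v v' -> R (c *: u + v) (c *: u' + v')) ->
  (forall u, U u -> exists u', U' u' /\ R u u') ->
  (forall u', U' u' -> exists u, U u /\ R u u') ->
  (forall u u', U u -> U' u' -> R u u' -> (W u <-> W' u')) ->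
  codim U W d -> codim U' W' d.
Proof.
move=> sU sU' R0 RL tot tot' RW [w [Uw spw frw]].
have [w' Hw'] := fin_all_exists (fun i => tot _ (Uw i)).
have Rlc c : R (lincomb w c) (lincomb w' c).
  rewrite /lincomb; elim/big_rec2: _ => // i u' u _ Ru.
  by apply: RL => //; case: (Hw' i).
have Uw' c : U' (lincomb w' c) by apply: subsp_lincomb => // i; case: (Hw' i).
exists w'; split.
- by move=> i; case: (Hw' i).
- move=> u' U'u'; have [u [Uu Ruu']] := tot' _ U'u'.
  have [c Wc] := spw _ Uu; exists c.
  apply/(RW (u - lincomb w c)) => //.
  + by apply: subspB => //; apply: subsp_lincomb.
  + by apply: subspB.
  + by have := RL (-1) _ _ _ _ (Rlc c) Ruu'; rewrite !scaleN1r ![- _ + _]addrC.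
move=> c Wc; apply: frw; apply/(RW _ (lincomb w' c)) => //.
exact: subsp_lincomb.
Qed.

(** Writing each basis in terms of the other modulo W gives two matrices whose product is the
    identity of size a and factors through size b. *)
Lemma codim_le V (U W : V -> Prop) a b :
  subsp U -> subsp W -> (forall u, W u -> U u) ->
  codim U W a -> codim U W b -> (a <= b)%N.
Proof.
move=> sU sW WU [w [Uw spw frw]] [w' [Uw' spw' frw']].
have [c Hc] := fin_all_exists (fun i => spw' _ (Uw i)).
have [c' Hc'] := fin_all_exists (fun i => spw _ (Uw' i)).
pose M := \matrix_i c i; pose M' := \matrix_i c' i.
have HM x : W (lincomb w x - lincomb w' (x *m M)).
  rewrite -lincomb_mul /lincomb -sumrB; apply: subsp_sum => // i _.
  by rewrite -scalerBr; apply: subspZ; rewrite // rowK.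
have HM' x : W (lincomb w' x - lincomb w (x *m M')).
  rewrite -lincomb_mul /lincomb -sumrB; apply: subsp_sum => // i _.
  by rewrite -scalerBr; apply: subspZ; rewrite // rowK.
have MM' : M *m M' = 1%:M.
  apply/row_matrixP => i; rewrite row_mul rowE row1; apply/esym/eqP.
  rewrite -subr_eq0; apply/eqP; apply: frw; rewrite lincombB.
  have := subspD sW (HM (delta_mx 0 i)) (HM' (delta_mx 0 i *m M)).
  by rewrite addrA subrK.
by have := mulmx_max_rank M M'; rewrite MM' mxrank1.
Qed.

Lemma codim_uniq V (U W : V -> Prop) a b :
  subsp U -> subsp W -> (forall u, W u -> U u) ->
  codim U W a -> codim U W b -> a = b.
Proof.
by move=> sU sW WU ca cb; apply/eqP; rewrite eqn_leq; apply/andP; split;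
   apply: (codim_le sU sW WU).
Qed.

(** P is not decidable, so excluded middle supplies a vector of P outside the current row space, if
    there is one. Adding it raises the rank, and the induction is on the corank. *)
Lemma subsp_rowspace a (P : 'rV[K]_a -> Prop) :
  subsp P -> exists B : 'M[K]_a, forall x, P x <-> (x <= B)%MS.
Proof.
move=> sP.
have PB (B : 'M[K]_a) x : (forall i, P (row i B)) -> (x <= B)%MS -> P x.
  move=> rB /submxP [y ->]; rewrite mulmx_sum_row; apply: subsp_sum => // i _.
  exact: subspZ.
have [B rB] : exists B : 'M[K]_a, forall i, P (row i B).
  by exists 0 => i; rewrite row0; case: sP.
move: {2}(a - \rank B)%N (leqnn (a - \rank B)) => k.
elim: k B rB => [|k IH] B rB hk.
  have fB : row_full B by rewrite /row_full eqn_leq rank_leq_col -subn_eq0 -leqn0.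
  by exists B => x; split=> [_|]; [apply: submx_full | apply: PB].
have [H|/not_all_ex_not [x /(imply_to_and (P x)) [Px /negP nx]]] :=
    classic (forall x, P x -> (x <= B)%MS).
  by exists B => x; split; [apply: H | apply: PB].
apply: (IH (B + x)%MS) => [i|].
  have /sub_addsmxP [[y z] /= ->] : (row i (B + x)%MS <= B + x)%MS by apply: row_sub.
  apply: subspD => //; first by apply: PB rB _; apply: submxMl.
  have /sub_rVP [c ->] : (z *m x <= x)%MS by apply: submxMl.
  exact: subspZ.
have ltB : (\rank B < \rank (B + x))%N.
  have : (B < B + x)%MS.
    rewrite ltmxE addsmxSl /=; apply: contra nx; apply: submx_trans.
    exact: addsmxSr.
  by rewrite ltmxErank => /andP [].
have := rank_leq_col (B + x)%MS; move: hk.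
by rewrite !leq_subLR => h1 _; rewrite (leq_trans h1) // addnS -addSn leq_add2r.
Qed.

(** This yields finite codimensions for subspaces that have not been computed. In coordinates along
    a basis of U modulo W, the intermediate space is a row space B; a complement of B gives the
    basis of U modulo U', and B itself that of U' modulo W. *)
Lemma codim_mid V (U U' W : V -> Prop) a :
  subsp U -> subsp U' -> subsp W ->
  (forall u, U' u -> U u) -> (forall u, W u -> U' u) ->
  codim U W a ->
  exists b c, [/\ codim U U' b, codim U' W c & a = (b + c)%N].
Proof.
move=> sU sU' sW U'U WU' [w [Uw spw frw]].
have sP : subsp (fun x => U' (lincomb w x)).
  split=> [|k x y Ux Uy]; first by rewrite lincomb0; case: sU'.
  by rewrite lincomb_linear; apply: (proj2 sU').
have [B HB] := subsp_rowspace sP.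
exists (\rank (B^C)%MS), (\rank B); split.
- exists (fun i => lincomb w (row i (row_base (B^C)%MS))); split.
  + by move=> i; apply: subsp_lincomb.
  + move=> u /spw [c Wc].
    have /sub_addsmxP [[y z] /= cE] : (c <= B + B^C)%MS.
      by apply: submx_full; apply: addsmx_compl_full.
    have /submxP [t tE] : (z *m B^C <= row_base B^C)%MS.
      by rewrite eq_row_base submxMl.
    exists t; rewrite lincomb_mul -tE.
    have Uy : U' (lincomb w (y *m B)) by apply/HB; apply: submxMl.
    rewrite -(subrK (lincomb w c) u) -addrA; apply: subspD => //; first exact: WU'.
    by rewrite -lincombB cE addrK.
  + move=> c; rewrite lincomb_mul => /HB H.
    have : (c *m row_base (B^C)%MS <= B :&: B^C)%MS.
      by rewrite sub_capmx H -(eq_row_base (B^C)%MS) submxMl.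
    rewrite capmx_compl submx0 => /eqP c0.
    by apply: (row_free_inj (row_base_free (B^C)%MS)); rewrite mul0mx.
- exists (fun i => lincomb w (row i (row_base B))); split.
  + move=> i; apply/HB; apply: submx_trans (row_sub _ _) _.
    by rewrite eq_row_base.
  + move=> u U'u; have [c Wc] := spw _ (U'U _ U'u).
    have /HB cB : U' (lincomb w c) by apply/(subspBK sU' (WU' _ Wc)).
    have /submxP [t tE] : (c <= row_base B)%MS by rewrite eq_row_base.
    by exists t; rewrite lincomb_mul -tE.
  + move=> c; rewrite lincomb_mul => /frw c0.
    by apply: (row_free_inj (row_base_free B)); rewrite mul0mx.
- by rewrite mxrank_compl subnK // rank_leq_col.
Qed.

Lemma codim0P V (U W : V -> Prop) : codim U W 0 -> forall u, U u -> W u.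
Proof.
move=> [w [_ sp _]] u /sp [c]; rewrite /lincomb big_ord0 subr0; exact.
Qed.

Lemma codim_self V (U W : V -> Prop) : (forall u, U u -> W u) -> codim U W 0.
Proof.
move=> UW; exists (fun i => 0); split.
- by case.
- by move=> u /UW Wu; exists 0; rewrite lincomb0 subr0.
by move=> c _; apply/rowP => -[].
Qed.

Lemma codim_ext V (U U' W W' : V -> Prop) d :
  (forall u, U u <-> U' u) -> (forall u, W u <-> W' u) ->
  codim U W d -> codim U' W' d.
Proof.
move=> UE WE [w [Uw sp fr]]; exists w; split.
- by move=> i; apply/UE.
- by move=> u /UE /sp [c /WE]; exists c.
by move=> c /WE; apply: fr.
Qed.

End Codim.

(** * Linear forms *)

Section LinearForms.
Variables (K : fieldType) (n : nat).
Local Notation S := {mpoly K[n]}.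
Implicit Types (u v P Q : 'rV[K]_n) (p q a b : S).

Definition lf v : S := \sum_j v 0 j *: 'X_j.

Definition dot v P : K := \sum_j v 0 j * P 0 j.

Lemma lf_is_linear c u v : lf (c *: u + v) = c *: lf u + lf v.
Proof.
rewrite /lf scaler_sumr -big_split /=; apply: eq_bigr => j _.
by rewrite !mxE scalerDl scalerA.
Qed.

HB.instance Definition _ := GRing.isLinear.Build K 'rV[K]_n S _ lf lf_is_linear.

Lemma dot_is_linear P : linear_for *%R (dot^~ P).
Proof.
move=> c u v; rewrite /dot mulr_sumr -big_split /=; apply: eq_bigr => j _.
by rewrite !mxE mulrDl mulrA.
Qed.

Lemma dotZl c u P : dot (c *: u) P = c * dot u P.
Proof. by have := dot_is_linear P c u 0; rewrite addr0 /dot [X in _ + X]big1 ?addr0 // => j _; rewrite mxE mul0r. Qed.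

Lemma dotDl u v P : dot (u + v) P = dot u P + dot v P.
Proof. by have := dot_is_linear P 1 u v; rewrite scale1r mul1r. Qed.

Lemma dotZr c u P : dot u (c *: P) = c * dot u P.
Proof. by rewrite /dot mulr_sumr; apply: eq_bigr => j _; rewrite mxE mulrCA. Qed.

Lemma dotE u P : dot u P = (u *m P^T) 0 0.
Proof. by rewrite mxE; apply: eq_bigr => j _; rewrite mxE. Qed.

Lemma dot_delta v k : dot v (delta_mx 0 k) = v 0 k.
Proof.
rewrite /dot (bigD1 k) //= mxE !eqxx mulr1 big1 ?addr0 // => j jk.
by rewrite mxE (negPf jk) andbF mulr0.
Qed.

Lemma dot_eq1 v : v != 0 -> exists Q, dot v Q = 1.
Proof.
case/rV0Pn => k vk; exists ((v 0 k)^-1 *: delta_mx 0 k).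
by rewrite dotZr dot_delta mulVf.
Qed.

Lemma dotC u v : dot u v = dot v u.
Proof. by rewrite /dot; apply: eq_bigr => j _; rewrite mulrC. Qed.

Lemma lf_homog v : lf v \is 1.-homog.
Proof.
by apply: rpred_sum => j _; apply: rpredZ; rewrite dhomogX /= mdeg1.
Qed.

Lemma lf_coef v j : (lf v)@_U_(j) = v 0 j.
Proof.
rewrite raddf_sum (bigD1 j) //= mcoeffZ mcoeffXU eqxx mulr1 big1 ?addr0 // => i ij.
by rewrite mcoeffZ mcoeffXU (negPf ij) mulr0.
Qed.

Lemma lf_eq0 v : (lf v == 0) = (v == 0).
Proof.
apply/eqP/eqP => [v0|->]; last exact: linear0.
by apply/rowP => j; rewrite -lf_coef v0 mcoeff0 mxE.
Qed.

Lemma lf_delta j : lf (delta_mx 0 j) = 'X_j.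
Proof.
rewrite /lf (bigD1 j) //= mxE !eqxx scale1r big1 ?addr0 // => i ij.
by rewrite mxE (negPf ij) andbF scale0r.
Qed.

Lemma lf_eval v P : (lf v).@[fun j => P 0 j] = dot v P.
Proof.
by rewrite raddf_sum; apply: eq_bigr => j _ /=; rewrite mevalZ mevalXU.
Qed.

Lemma lf_comp k (x : n.-tuple {mpoly K[k]}) v :
  lf v \mPo x = \sum_j v 0 j *: tnth x j.
Proof.
rewrite /lf raddf_sum; apply: eq_bigr => j _ /=.
by rewrite comp_mpolyZ comp_mpolyXU -tnth_nth.
Qed.

Definition ideal (I : S -> Prop) : Prop :=
  [/\ I 0, forall a b, I a -> I b -> I (a + b) & forall c a, I a -> I (c * a)].

Lemma idealN (I : S -> Prop) a : ideal I -> I a -> I (- a).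
Proof. by case=> _ _ H Ia; rewrite -mulN1r; apply: H. Qed.

Lemma idealB (I : S -> Prop) a b : ideal I -> I a -> I b -> I (a - b).
Proof. by move=> iI Ia Ib; case: (iI) => _ H _; apply: H => //; apply: idealN. Qed.

Lemma idealZ (I : S -> Prop) (c : K) a : ideal I -> I a -> I (c *: a).
Proof. by case=> _ _ H Ia; rewrite -mul_mpolyC; apply: H. Qed.

Lemma ideal_subsp (I : S -> Prop) : ideal I -> subsp I.
Proof.
move=> iI; case: (iI) => I0 ID IM; split=> // c u v Iu Iv.
by apply: ID => //; apply: idealZ.
Qed.

Lemma ideal_comp_congr (I : S -> Prop) (x y : n.-tuple S) p :
  ideal I -> (forall j, I (tnth x j - tnth y j)) -> I ((p \mPo x) - (p \mPo y)).
Proof.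
move=> iI xy; case: (iI) => I0 ID IM.
have congM a b a' b' : I (a - a') -> I (b - b') -> I (a * b - a' * b').
  move=> Ia Ib; have -> : a * b - a' * b' = b * (a - a') + a' * (b - b') by ring.
  by apply: ID; apply: IM.
have prd (m : 'X_{1..n}) :
    I (\prod_i tnth x i ^+ m i - \prod_i tnth y i ^+ m i).
  elim/big_rec2: _ => [|i a b _ Iab]; first by rewrite subrr.
  apply: (congM) => //; elim: (m i) => [|k IH]; first by rewrite !expr0 subrr.
  by rewrite !exprS; apply: congM.
rewrite !comp_mpolyE -sumrB; elim/big_ind: _ => // m _.
by rewrite -scalerBr; apply: idealZ.
Qed.

Lemma pdvd_ideal p : ideal (pdvd p).
Proof.
split=> [|a b [c ->] [d ->]|c a [d ->]]; first by exists 0; rewrite mulr0.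
  by exists (c + d); rewrite mulrDr.
by exists (c * d); rewrite mulrCA.
Qed.

Lemma pdvdZ p c a : pdvd p a -> pdvd p (c *: a).
Proof. by move=> H; apply: idealZ => //; apply: pdvd_ideal. Qed.

Lemma pdvdD p a b : pdvd p a -> pdvd p b -> pdvd p (a + b).
Proof. by case: (pdvd_ideal p) => _ H _; apply: H. Qed.

Lemma pdvdB p a b : pdvd p a -> pdvd p b -> pdvd p (a - b).
Proof. by move=> *; apply: idealB => //; apply: pdvd_ideal. Qed.

Lemma pdvd_mull p a b : pdvd p b -> pdvd p (a * b).
Proof. by case: (pdvd_ideal p) => _ _ H; apply: H. Qed.

Lemma pdvd_mulr p a b : pdvd p a -> pdvd p (a * b).
Proof. by rewrite mulrC; apply: pdvd_mull. Qed.

Lemma pdvd_refl p : pdvd p p.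
Proof. by exists 1; rewrite mulr1. Qed.

Lemma pdvd0 p : pdvd p 0.
Proof. by exists 0; rewrite mulr0. Qed.

Lemma pdvd_trans p q a : pdvd p q -> pdvd q a -> pdvd p a.
Proof. by case=> c -> [d ->]; rewrite -mulrA; exists (c * d). Qed.

Lemma pdvd_scalel p c a : c != 0 -> pdvd (c *: p) a <-> pdvd p a.
Proof.
move=> c0; split=> -[d ->]; first by rewrite -scalerAl scalerAr; exists (c *: d).
by exists (c^-1 *: d); rewrite -scalerAl -scalerAr scalerA mulfV // scale1r.
Qed.

(* Substituting [x_j - Q_j lf v], where [v . Q = 1], is a retraction of [S]
   whose kernel is the ideal of [lf v]. *)
Definition retr v Q p : S :=
  p \mPo [tuple 'X_j - Q 0 j *: lf v | j < n].

Lemma retrM v Q p q : retr v Q (p * q) = retr v Q p * retr v Q q.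
Proof. exact: rmorphM. Qed.

Lemma retr_lf v Q u : retr v Q (lf u) = lf (u - dot u Q *: v).
Proof.
rewrite /retr lf_comp linearB linearZ /= /lf /dot scaler_suml -sumrB.
by apply: eq_bigr => j _; rewrite tnth_mktuple scalerBr scalerA.
Qed.

Lemma retr_congr v Q p : pdvd (lf v) (p - retr v Q p).
Proof.
rewrite -{1}[p]comp_mpoly_id; apply: ideal_comp_congr; first exact: pdvd_ideal.
move=> j; rewrite !tnth_mktuple opprB addrC subrK.
apply: pdvdZ; exact: pdvd_refl.
Qed.

Lemma lf_dvdP v Q p : dot v Q = 1 -> pdvd (lf v) p <-> retr v Q p = 0.
Proof.
move=> vQ; split=> [[c ->]|r0].
  by rewrite retrM retr_lf vQ scale1r subrr linear0 mul0r.
by have := retr_congr v Q p; rewrite r0 subr0.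
Qed.

(** The ideal of a nonzero linear form is the kernel of a ring morphism to a domain. *)
Lemma lf_prime v a b :
  v != 0 -> pdvd (lf v) (a * b) -> pdvd (lf v) a \/ pdvd (lf v) b.
Proof.
case/dot_eq1 => Q vQ /(lf_dvdP _ vQ) /eqP; rewrite retrM mulf_eq0.
by case/orP => /eqP /(lf_dvdP _ vQ); [left | right].
Qed.

Lemma lf_dvd_lf v u : v != 0 -> pdvd (lf v) (lf u) -> (u <= v)%MS.
Proof.
case/dot_eq1 => Q vQ /(lf_dvdP _ vQ) /eqP; rewrite retr_lf lf_eq0 subr_eq0.
by move/eqP ->; apply: scalemx_sub.
Qed.

Lemma lf_dvd1 v : v != 0 -> ~ pdvd (lf v) 1.
Proof.
case/dot_eq1 => Q vQ /(lf_dvdP _ vQ); rewrite /retr rmorph1 => /eqP.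
by rewrite oner_eq0.
Qed.

Lemma lf_prime_prod (I : eqType) (s : seq I) (F : I -> S) v :
  v != 0 -> pdvd (lf v) (\prod_(i <- s) F i) ->
  exists2 i, i \in s & pdvd (lf v) (F i).
Proof.
move=> v0; elim: s => [|i s IH]; first by rewrite big_nil => /(lf_dvd1 v0).
rewrite big_cons => /(lf_prime v0) [Hi|/IH [j js Hj]].
  by exists i; rewrite ?mem_head.
by exists j; rewrite // in_cons js orbT.
Qed.

Lemma lf_prod_dvd (I : eqType) (s : seq I) (v : I -> 'rV[K]_n) p :
  uniq s -> (forall i, i \in s -> v i != 0) ->
  (forall i j, i \in s -> j \in s -> i != j -> ~~ (v i <= v j)%MS) ->
  (forall i, i \in s -> pdvd (lf (v i)) p) ->
  pdvd (\prod_(i <- s) lf (v i)) p.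
Proof.
elim: s p => [|i s IH] p; first by move=> *; rewrite big_nil; exists p; rewrite mul1r.
rewrite [uniq _]/= => /andP [nis us] v0 vn vd.
have hs j : j \in s -> j \in i :: s by rewrite in_cons => ->; rewrite orbT.
have [q qE] : pdvd (\prod_(j <- s) lf (v j)) p.
  by apply: IH => //; move=> *; auto.
have : pdvd (lf (v i)) p by apply: vd; rewrite mem_head.
rewrite qE => /lf_prime [||[c ->]]; first by apply: v0; rewrite mem_head.
  move/(lf_prime_prod (v0 _ (mem_head _ _))) => [j js /lf_dvd_lf].
  rewrite v0 ?mem_head // => /(_ isT) H.
  have ji : j != i by apply: contraNneq nis => <-.
  by move: (vn j i (hs _ js) (mem_head _ _) ji); rewrite H.
by rewrite big_cons mulrA [lf _ * _]mulrC; exists c; rewrite ?mulrA.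
Qed.

(* The linear forms vanishing at [P] generate the kernel of the substitution
   [x_j -> P_j g], for any linear form [g] with [g(P) = 1]. *)
Definition evp g P p : S := p \mPo [tuple P 0 j *: lf g | j < n].

Lemma evpM g P p q : evp g P (p * q) = evp g P p * evp g P q.
Proof. exact: rmorphM. Qed.

Lemma evp_lf g P u : evp g P (lf u) = dot u P *: lf g.
Proof.
rewrite /evp lf_comp /dot scaler_suml.
by apply: eq_bigr => j _; rewrite tnth_mktuple scalerA.
Qed.

(** For a homogeneous polynomial the substitution retains only the value at P, so membership in the
    ideal of the point is a single linear condition. *)
Lemma evp_homog g P d p :
  p \is d.-homog -> evp g P p = p.@[fun j => P 0 j] *: lf g ^+ d.
Proof.
move=> /dhomogP hp; rewrite /evp comp_mpolyE mevalE scaler_suml big_seq [RHS]big_seq.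
apply: eq_bigr => m /hp /= <-; rewrite -scalerA; congr (_ *: _).
rewrite mdegE -mul_mpolyC rmorph_prod -prodrXr -big_split /=.
by apply: eq_bigr => i _; rewrite tnth_mktuple exprZn rmorphXn /= -rmorphXn mul_mpolyC.
Qed.

Lemma evp_congr (I : S -> Prop) g P p : ideal I -> dot g P = 1 ->
  (forall u, dot u P = 0 -> I (lf u)) -> I (p - evp g P p).
Proof.
move=> iI gP Iu; rewrite -{1}[p]comp_mpoly_id; apply: ideal_comp_congr => //.
move=> j; rewrite !tnth_mktuple -lf_delta -linearZ -linearB /=; apply: Iu.
by rewrite -scaleNr dotDl dotZl gP mulr1 dotC dot_delta subrr.
Qed.

Lemma hyperplane_point (W : 'M[K]_n) : (\rank W).+1 = n ->
  exists P, forall u, (u <= W)%MS <-> dot u P = 0.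
Proof.
move=> rW; have rC : \rank (cokermx W) = 1%N.
  by rewrite mxrank_coker -[X in (X - _)%N]rW subSnn.
(* The cokernel of W has rank one, hence is a column times a row, and the column is the point. The
   rank is generalised to [r] so that it can be replaced by 1 in the types of [L] and [R]. *)
have [r [L [R [r1 CE fR]]]] : exists r (L : 'M[K]_(n, r)) (R : 'M[K]_(r, n)),
    [/\ r = 1%N, cokermx W = L *m R & row_free R].
  exists (\rank (cokermx W)), (col_base (cokermx W)), (row_base (cokermx W)).
  by rewrite mulmx_base row_base_free.
move: L R CE fR; rewrite {}r1 => L R CE fR; exists L^T => u.
rewrite dotE trmxK submxE CE mulmxA; split=> [/eqP H|H].
  by have /(row_free_inj fR) -> : u *m L *m R = 0 *m R; rewrite ?mxE // H mul0mx.
by apply/eqP; rewrite [u *m L]mx11_scalar H raddf0 mul0mx.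
Qed.

(** This lets the witness of a divisibility between homogeneous polynomials be replaced by a
    homogeneous one. Only the component of q of degree d - k contributes in degree d. *)
Lemma pihomogMl d k a q : a \is k.-homog ->
  pihomog mdeg d (a * q) = if (k <= d)%N then a * pihomog mdeg (d - k) q else 0.
Proof.
move=> ha; rewrite {1}(pihomog_partitionE (leqnn (mmeasure mdeg q))).
set s := mmeasure _ _; rewrite mulr_sumr raddf_sum /=.
have E (i : 'I_s) : pihomog mdeg d (a * pihomog mdeg i q) =
    if (k + i == d)%N then a * pihomog mdeg i q else 0.
  have hi : a * pihomog mdeg i q \is (k + i).-homog by apply: dhomogM => //; apply: pihomogP.
  by case: eqP => [<-|/eqP ne]; [rewrite pihomog_dE | rewrite (pihomog_ne0 ne)].
under eq_bigr => i _ do rewrite E.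
case: leqP => [kd|dk]; last first.
  apply: big1 => i _; case: eqP => // e.
  by move: dk; rewrite -e ltnNge leq_addr.
have E' (i : 'I_s) : (k + i == d)%N = (i == (d - k)%N :> nat).
  by rewrite -[in LHS](subnKC kd) eqn_add2l.
under eq_bigr => i _ do rewrite E'.
case: (ltnP (d - k) s) => [lt|ge].
  rewrite (bigD1 (Ordinal lt)) //= eqxx big1 ?addr0 // => i /eqP ne.
  by case: eqP => // e; case: ne; apply: val_inj.
rewrite big1 => [|i _]; last by case: eqP => // e; move: ge; rewrite -e leqNgt ltn_ord.
apply/esym/eqP; rewrite mulf_eq0; apply/orP; right; apply/eqP.
rewrite /pihomog big_seq_cond big1 // => m /andP [ms /eqP e].
by have := mmeasure_mnm_lt mdeg ms; rewrite /= e -/s ltnNge ge.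
Qed.

Lemma homog_quot d k a q : a \is k.-homog -> a * q \is (k + d).-homog ->
  a * q = a * pihomog mdeg d q.
Proof.
by move=> ha /pihomog_dE {1}<-; rewrite (pihomogMl _ _ ha) leq_addr addKn.
Qed.

Lemma pdvd_pihomog d k a p : a \is k.-homog ->
  pdvd a p -> pdvd a (pihomog mdeg d p).
Proof.
move=> ha [c ->]; rewrite (pihomogMl _ _ ha); case: ifP => _; last exact: pdvd0.
by eexists.
Qed.

Lemma homog_small d k a q : a \is k.-homog -> a * q \is d.-homog ->
  (d < k)%N -> a * q = 0.
Proof.
by move=> ha /pihomog_dE <- dk; rewrite (pihomogMl _ _ ha) leqNgt dk.
Qed.

Lemma lf_prod_homog (I : Type) (s : seq I) (v : I -> 'rV[K]_n) :
  \prod_(i <- s) lf (v i) \is (size s).-homog.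
Proof.
elim: s => [|i s IH]; first by rewrite big_nil; apply: dhomog1.
by rewrite big_cons -[size _]add1n; apply: dhomogM => //; apply: lf_homog.
Qed.

Lemma lfX_homog v d : lf v ^+ d \is d.-homog.
Proof. by have := dhomogMn d (lf_homog v); rewrite mul1n. Qed.

Lemma homog_subsp d : subsp (fun p : S => p \is d.-homog).
Proof.
split=> [|c u v hu hv]; first exact: dhomog0.
by apply: dhomogD => //; apply: dhomogZ.
Qed.

Lemma codim_eval d P : P != 0 ->
  codim (fun p : S => p \is d.-homog)
        (fun p => p \is d.-homog /\ p.@[fun j => P 0 j] = 0) 1.
Proof.
case/dot_eq1 => g gP.
have ev : (lf g ^+ d).@[fun j => P 0 j] = 1.
  by rewrite rmorphXn /= lf_eval dotC gP expr1n.
exists (fun=> lf g ^+ d); split.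
- by move=> i; apply: lfX_homog.
- move=> p hp; exists (\row_i p.@[fun j => P 0 j]).
  rewrite /lincomb big_ord1 mxE; split.
    by apply: rpredB => //; apply: rpredZ; apply: lfX_homog.
  by rewrite mevalB mevalZ ev mulr1 subrr.
move=> c [_]; rewrite /lincomb big_ord1 mevalZ ev mulr1 => c0.
by apply/rowP => i; rewrite ord1 c0 mxE.
Qed.

End LinearForms.

(** * Points as zeros of linear forms, and dimensions of spaces of homogeneous polynomials *)

Section Points.
Variable K : fieldType.

Lemma rank_adds_rV n (u v : 'rV[K]_n) :
  u != 0 -> ~~ (v <= u)%MS -> \rank (u + v)%MS = 2%N.
Proof.
move=> u0 vu; apply/eqP; rewrite eqn_leq; apply/andP; split.
  apply: leq_trans (mxrank_adds_leqif u v).1 _.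
  by rewrite (leq_add (rank_leq_row u) (rank_leq_row v)).
have : (u < u + v)%MS.
  rewrite ltmxE addsmxSl /=; apply: contra vu; apply: submx_trans.
  exact: addsmxSr.
by rewrite ltmxErank rank_rV u0 => /andP [].
Qed.

Lemma hyperplane_point_neq0 n (W : 'M[K]_n) : (\rank W).+1 = n ->
  exists2 P : 'rV[K]_n, P != 0 & forall u, (u <= W)%MS <-> dot u P = 0.
Proof.
move=> rW; have [P HP] := hyperplane_point rW; exists P => //.
apply/negP => /eqP P0; have : (1%:M <= W)%MS.
  apply/row_subP => i; apply/HP; rewrite P0 /dot big1 // => j _.
  by rewrite !mxE mulr0.
by move/mxrankS; rewrite mxrank1 -{1}rW ltnn.
Qed.

Lemma point1 (v : 'rV[K]_2) : v != 0 ->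
  exists2 P : 'rV[K]_2, P != 0 & forall u, (u <= v)%MS <-> dot u P = 0.
Proof.
move=> v0; have [|P P0 HP] := @hyperplane_point_neq0 2 <<v>>%MS.
  by rewrite genmxE rank_rV v0.
by exists P => // u; rewrite -HP genmxE.
Qed.

Lemma point2 (u v : 'rV[K]_3) : u != 0 -> ~~ (v <= u)%MS ->
  exists2 P : 'rV[K]_3, P != 0 & forall w, (w <= u + v)%MS <-> dot w P = 0.
Proof.
move=> u0 vu; have [|P P0 HP] := @hyperplane_point_neq0 3 (u + v)%MS.
  by rewrite rank_adds_rV.
by exists P.
Qed.

Lemma lf_dvd_eval n (v P : 'rV[K]_n) p : dot v P = 0 ->
  pdvd (lf v) p -> p.@[fun j => P 0 j] = 0.
Proof. by move=> vP [c ->]; rewrite mevalM lf_eval vP mul0r. Qed.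

Lemma lf_dvd_homogP (v P : 'rV[K]_2) d p : P != 0 -> p \is d.-homog ->
  (forall u, (u <= v)%MS <-> dot u P = 0) ->
  pdvd (lf v) p <-> p.@[fun j => P 0 j] = 0.
Proof.
move=> P0 hp vP; split=> [|p0]; first by apply: lf_dvd_eval; apply/vP.
have [g] := dot_eq1 P0; rewrite dotC => gP.
have := @evp_congr _ _ (pdvd (lf v)) g P p (pdvd_ideal _) gP.
rewrite (evp_homog _ _ hp) p0 scale0r subr0; apply=> u /vP /sub_rVP [c ->].
by rewrite linearZ; apply: pdvdZ; apply: pdvd_refl.
Qed.

(** For independent u and v, the homogeneous ideal of the point where the two projective lines
    meet. *)
Definition ideal2 (u v : 'rV[K]_3) (p : {mpoly K[3]}) : Prop :=
  exists a b, p = lf u * a + lf v * b.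

Lemma ideal2_ideal u v : ideal (ideal2 u v).
Proof.
split.
- by exists 0, 0; rewrite !mulr0 addr0.
- by move=> _ _ [a [b ->]] [c [d ->]]; exists (a + c), (b + d); ring.
by move=> c _ [a [b ->]]; exists (c * a), (c * b); ring.
Qed.

(** Here p need not be homogeneous. As a kernel of a morphism to a domain, the ideal of the point is
    prime. *)
Lemma ideal2_evpP u v g P p : dot g P = 1 ->
  (forall w, (w <= u + v)%MS <-> dot w P = 0) ->
  ideal2 u v p <-> evp g P p = 0.
Proof.
move=> gP uvP.
have uP : dot u P = 0 by apply/uvP; apply: addsmxSl.
have vP : dot v P = 0 by apply/uvP; apply: addsmxSr.
split=> [[a [b ->]]|p0].
  by rewrite /evp raddfD /= -!/(evp _ _ _) !evpM !evp_lf uP vP !scale0r !mul0r addr0.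
have := @evp_congr _ _ _ g P p (ideal2_ideal u v) gP.
rewrite p0 subr0; apply=> w /uvP /sub_addsmxP [[y z] /= ->].
have [c ->] : exists c, y *m u = c *: u by apply/sub_rVP; apply: submxMl.
have [d ->] : exists d, z *m v = d *: v by apply/sub_rVP; apply: submxMl.
exists c%:MP, d%:MP; rewrite linearD !linearZ /=.
by rewrite -!mul_mpolyC ![lf _ * _]mulrC.
Qed.

Lemma ideal2_homogP u v P d p : P != 0 -> p \is d.-homog ->
  (forall w, (w <= u + v)%MS <-> dot w P = 0) ->
  ideal2 u v p <-> p.@[fun j => P 0 j] = 0.
Proof.
move=> P0 hp uvP; have [g] := dot_eq1 P0; rewrite dotC => gP.
rewrite (ideal2_evpP _ gP uvP) (evp_homog _ _ hp).
split=> [/eqP|->]; last by rewrite scale0r.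
rewrite scaler_eq0 expf_eq0 lf_eq0 => /orP [/eqP //|/andP [_ /eqP g0]].
by move: gP; rewrite g0 /dot big1 => [/eqP|j _]; rewrite ?mxE ?mul0r // eq_sym oner_eq0.
Qed.

(** On the line v = 0 the forms of degree N make a space of dimension N + 1, by induction: vanishing
    at one point P of the line is one condition, and the forms that satisfy it are, modulo [lf v],
    the multiples of a second line [lf u] through P. *)
Lemma codim_lf3 (v : 'rV[K]_3) N : v != 0 ->
  codim (fun p : {mpoly K[3]} => p \is N.-homog)
        (fun p => p \is N.-homog /\ pdvd (lf v) p) N.+1.
Proof.
move=> v0.
have [u uv] : exists u : 'rV[K]_3, ~~ (u <= v)%MS.
  have /row_subPn [i ni] : ~~ ((1%:M : 'M[K]_3) <= v)%MS.
    by apply/negP => /mxrankS; rewrite mxrank1 rank_rV v0.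
  by exists (row i 1%:M).
have [P P0 HP] := point2 v0 uv.
have sI N' : subsp (fun p : {mpoly K[3]} => p \is N'.-homog /\ ideal2 v u p).
  by apply: subspI; [apply: homog_subsp | apply/ideal_subsp/ideal2_ideal].
have sV N' : subsp (fun p : {mpoly K[3]} => p \is N'.-homog /\ pdvd (lf v) p).
  by apply: subspI; [apply: homog_subsp | apply/ideal_subsp/pdvd_ideal].
have vI N' p : p \is N'.-homog /\ pdvd (lf v) p -> p \is N'.-homog /\ ideal2 v u p.
  by case=> hp [c pc]; split=> //; exists c, 0; rewrite mulr0 addr0.
have c1 N' : codim (fun p : {mpoly K[3]} => p \is N'.-homog)
    (fun p => p \is N'.-homog /\ ideal2 v u p) 1.
  apply: codim_ext (codim_eval N' P0) => // p.
  split=> -[hp Hp]; split=> //; by apply/(ideal2_homogP P0 hp HP).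
elim: N => [|N IH].
  apply: (@codim_trans _ _ _ _ _ 1 0 (homog_subsp _ _ _) (sI _) (sV _) _ (vI _) (c1 _)) => [p []|] //.
  apply: codim_self => p [hp [a [b pE]]]; split=> //.
  have -> : p = 0; last exact: pdvd0.
  rewrite -(pihomog_dE hp) pE pihomogD.
  by rewrite !(pihomogMl _ _ (lf_homog _)) addr0.
apply: (@codim_trans _ _ _ _ _ 1 N.+1 (homog_subsp _ _ _) (sI _) (sV _) _ (vI _) (c1 _)) => [p []|] //.
apply: (codim_rel (R := fun w p => pdvd (lf v) (p - lf u * w))) IH => //.
- exact: homog_subsp.
- by rewrite mulr0 subr0; apply: pdvd0.
- move=> c w w' p p' H H'.
  have -> : c *: p + p' - lf u * (c *: w + w') = c *: (p - lf u * w) + (p' - lf u * w').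
    by rewrite mulrDr scalerBr -scalerAr; ring.
  by apply: pdvdD => //; apply: pdvdZ.
- move=> w hw; exists (lf u * w); rewrite subrr; split; last exact: pdvd0.
  split; first by rewrite -(add1n N); apply: dhomogM => //; apply: lf_homog.
  by exists 0, w; rewrite mulr0 add0r.
- move=> p [hp [a [b pE]]]; exists (pihomog mdeg N b); split; first exact: pihomogP.
  rewrite -(pihomog_dE hp) pE pihomogD !(pihomogMl _ _ (lf_homog _)) /= subn1 /=.
  by rewrite addrK; eexists.
move=> w p hw [hp _] [c pc].
have pE : p = lf u * w + lf v * c by rewrite -pc addrC subrK.
split=> [[_ vw]|[_ vp]]; split=> //.
  by rewrite pE; apply: pdvdD; [apply: pdvd_mull | eexists].
have : pdvd (lf v) (lf u * w).
  have -> : lf u * w = p - lf v * c by rewrite pE addrK.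
  by apply: pdvdB => //; eexists.
by case/(lf_prime v0) => // /(lf_dvd_lf v0); rewrite (negPf uv).
Qed.

Lemma eq0_subsp (V : lmodType K) : subsp (fun p : V => p = 0).
Proof. by split=> // c u v -> ->; rewrite scaler0 addr0. Qed.

Lemma codim_homog2 N :
  codim (fun p : {mpoly K[2]} => p \is N.-homog) (fun p => p = 0) N.+1.
Proof.
pose v : 'rV[K]_2 := delta_mx 0 0.
have v0 : v != 0 by apply/rV0Pn; exists 0; rewrite mxE !eqxx oner_eq0.
have [P P0 HP] := point1 v0.
have sV N' : subsp (fun p : {mpoly K[2]} => p \is N'.-homog /\ pdvd (lf v) p).
  by apply: subspI; [apply: homog_subsp | apply/ideal_subsp/pdvd_ideal].
have c1 N' : codim (fun p : {mpoly K[2]} => p \is N'.-homog)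
    (fun p => p \is N'.-homog /\ pdvd (lf v) p) 1.
  apply: codim_ext (codim_eval N' P0) => // p.
  split=> -[hp Hp]; split=> //; by apply/(lf_dvd_homogP P0 hp HP).
have z N' p : p = 0 -> p \is N'.-homog /\ pdvd (lf v) p.
  by move->; split; [apply: dhomog0 | apply: pdvd0].
elim: N => [|N IH].
  apply: (@codim_trans _ _ _ _ _ 1 0 (homog_subsp _ _ _) (sV _) (@eq0_subsp _) _ (z _) (c1 _)) => [p []|] //.
  apply: codim_self => p [hp [c pc]].
  by rewrite -(pihomog_dE hp) pc (pihomogMl _ _ (lf_homog _)).
apply: (@codim_trans _ _ _ _ _ 1 N.+1 (homog_subsp _ _ _) (sV _) (@eq0_subsp _) _ (z _) (c1 _)) => [p []|] //.
apply: (codim_rel (R := fun w p => p = lf v * w)) IH => //.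
- exact: homog_subsp.
- by rewrite mulr0.
- by move=> c w w' p p' -> ->; rewrite mulrDr -scalerAr.
- move=> w hw; exists (lf v * w); split=> //; split; last by eexists.
  by rewrite -(add1n N); apply: dhomogM => //; apply: lf_homog.
- move=> p [hp [b pE]]; exists (pihomog mdeg N b); split; first exact: pihomogP.
  by rewrite -(pihomog_dE hp) pE (pihomogMl _ _ (lf_homog _)) /= subn1.
move=> w p hw _ ->; split=> [->|/eqP]; first by rewrite mulr0.
by rewrite mulf_eq0 lf_eq0 (negPf v0) => /eqP.
Qed.

Lemma codim_pair (V V' : lmodType K) (U W : V -> Prop) (U' W' : V' -> Prop) a b :
  subsp U -> subsp W -> subsp U' -> subsp W' ->
  (forall u, W u -> U u) -> (forall u, W' u -> U' u) ->
  codim U W a -> codim U' W' b ->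
  codim (fun g : V * V' => U g.1 /\ U' g.2) (fun g => W g.1 /\ W' g.2) (a + b).
Proof.
have sp (X : V -> Prop) (X' : V' -> Prop) : subsp X -> subsp X' ->
    subsp (fun g : V * V' => X g.1 /\ X' g.2).
  move=> [X0 HX] [X'0 HX']; split=> // c u v [??] [??].
  by split; [apply: HX | apply: HX'].
move=> sU sW sU' sW' WU WU' ca cb.
apply: (@codim_trans _ _ _ (fun g => W g.1 /\ U' g.2)); try exact: sp.
- by move=> g [/WU ? ?].
- by move=> g [? /WU' ?].
- apply: (codim_rel (R := fun u g => g.1 = u)) ca => //; first exact: sp.
  + by move=> c u v u' v' /= -> ->.
  + by move=> u Uu; exists (u, 0); split=> //; split=> //=; case: sU'.
  + by move=> g [? ?]; exists g.1.
  + by move=> u g _ [_ ?] <-; split=> [|[]].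
apply: (codim_rel (R := fun u g => g.2 = u)) cb => //; first exact: sp.
+ by move=> c u v u' v' /= -> ->.
+ by move=> u Uu; exists (0, u); split=> //; split=> //=; case: sW.
+ by move=> g [? ?]; exists g.2.
by move=> u g _ [? _] <-; split=> [|[]].
Qed.

End Points.

(** * Multiarrangements in the plane *)

Section PlaneMulti.
Variable K : fieldType.

(* The value of the derivation [g] at the linear form [u]. *)
Definition act n (u : 'rV[K]_2) (g : {mpoly K[n]} * {mpoly K[n]}) : {mpoly K[n]} :=
  u 0 0 *: g.1 + u 0 1 *: g.2.

Definition pscal n (f : {mpoly K[n]}) (g : {mpoly K[n]} * {mpoly K[n]}) :=
  (f * g.1, f * g.2).

Definition homog_pair n d (g : {mpoly K[n]} * {mpoly K[n]}) : Prop :=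
  g.1 \is d.-homog /\ g.2 \is d.-homog.

Lemma actD n u (g g' : {mpoly K[n]} * {mpoly K[n]}) : act u (g + g') = act u g + act u g'.
Proof. by rewrite /act /= !scalerDr; ring. Qed.

Lemma actZ n u c (g : {mpoly K[n]} * {mpoly K[n]}) : act u (c *: g) = c *: act u g.
Proof. by rewrite /act /= scalerDr !scalerA ![c * _]mulrC. Qed.

Lemma act_scale n u c (g : {mpoly K[n]} * {mpoly K[n]}) : act (c *: u) g = c *: act u g.
Proof. by rewrite /act /= !mxE scalerDr !scalerA. Qed.

Lemma act_pscal n u f (g : {mpoly K[n]} * {mpoly K[n]}) : act u (pscal f g) = f * act u g.
Proof. by rewrite /act /= mulrDr !scalerAr. Qed.

Lemma act_homog n u d (g : {mpoly K[n]} * {mpoly K[n]}) :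
  homog_pair d g -> act u g \is d.-homog.
Proof. by case=> h1 h2; apply: rpredD; apply: rpredZ. Qed.

Lemma homog_pair_subsp n d : subsp (@homog_pair n d).
Proof.
split=> [|c u v [h1 h2] [h1' h2']]; first by split; apply: dhomog0.
by split; apply: dhomogD => //; apply: dhomogZ.
Qed.

Lemma homog_pair_scal n d e f (g : {mpoly K[n]} * {mpoly K[n]}) :
  f \is d.-homog -> homog_pair e g -> homog_pair (d + e) (pscal f g).
Proof. by move=> hf [h1 h2]; split; apply: dhomogM. Qed.

Lemma const_field n (u : 'rV[K]_2) : u != 0 ->
  exists c : {mpoly K[n]} * {mpoly K[n]}, act u c = 1.
Proof.
case/dot_eq1 => w uw; exists ((w 0 0)%:MP, (w 0 1)%:MP).
rewrite /act /= -!mul_mpolyC -!mpolyCM -mpolyCD.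
suff -> : u 0 0 * w 0 0 + u 0 1 * w 0 1 = 1 by [].
by rewrite -uw /dot big_ord_recl big_ord1; congr (_ + u 0 _ * w 0 _); apply: val_inj.
Qed.

Local Notation S := {mpoly K[2]}.

Definition gbasis (D : S * S -> Prop) (th1 th2 : S * S) : Prop :=
  [/\ D th1, D th2,
      forall g, D g -> exists f1 f2, g = pscal f1 th1 + pscal f2 th2 &
      forall f1 f2, pscal f1 th1 + pscal f2 th2 = 0 -> f1 = 0 /\ f2 = 0].

Definition submod (D : S * S -> Prop) : Prop :=
  [/\ D 0, forall g g', D g -> D g' -> D (g + g') & forall f g, D g -> D (pscal f g)].

Lemma submod_subsp D : submod D -> subsp D.
Proof.
case=> D0 DD DM; split=> // c u v Du Dv; apply: DD => //.
suff -> : c *: u = pscal c%:MP u by apply: DM.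
by rewrite /pscal !mul_mpolyC.
Qed.

Lemma gbasis_swap D th1 th2 : gbasis D th1 th2 -> gbasis D th2 th1.
Proof.
case=> D1 D2 sp fr; split=> // [g /sp [f1 [f2 ->]]|f1 f2].
  by exists f2, f1; rewrite addrC.
by rewrite addrC => /fr [].
Qed.

Lemma gbasis_shear D th1 th2 f : submod D ->
  gbasis D th1 th2 -> gbasis D th1 (th2 + pscal f th1).
Proof.
case=> D0 DD DM [D1 D2 sp fr]; split=> //.
- by apply: DD => //; apply: DM.
- move=> g /sp [f1 [f2 ->]]; exists (f1 - f2 * f), f2.
  by congr pair => /=; ring.
move=> f1 f2 E.
have [|E1 E2] := fr (f1 + f2 * f) f2.
  by rewrite -[RHS]E; congr pair => /=; ring.
by move: E1; rewrite E2 mul0r addr0.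
Qed.

Lemma gbasis_step D u k th1 th2 h1 h2 : u != 0 ->
  (forall g, D g -> pdvd (lf u ^+ k) (act u g)) ->
  gbasis D th1 th2 -> submod D ->
  act u th1 = lf u ^+ k * h1 -> act u th2 = lf u ^+ k * h2 ->
  ~ pdvd (lf u) h1 -> pdvd (lf u) h2 ->
  gbasis (fun g => D g /\ pdvd (lf u ^+ k.+1) (act u g)) (pscal (lf u) th1) th2.
Proof.
move=> u0 Dk [D1 D2 sp fr] [D0 DD DM] E1 E2 n1 [c2 hc2].
have lu0 : lf u != 0 by rewrite lf_eq0.
have luk0 : lf u ^+ k != 0 by rewrite expf_neq0.
split.
- split; first exact: DM.
  by rewrite act_pscal E1 exprS mulrA; exists h1.
- by split=> //; rewrite E2 hc2 exprSr mulrA; exists c2.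
- move=> g [/sp [f1 [f2 ->]]]; rewrite actD !act_pscal E1 E2 => -[c].
  rewrite exprSr -mulrA => Ec.
  have {}Ec : f1 * h1 + f2 * h2 = lf u * c.
    by apply: (mulfI luk0); rewrite -Ec; ring.
  have : pdvd (lf u) (f1 * h1).
    have -> : f1 * h1 = lf u * c - f2 * h2 by rewrite -Ec addrK.
    by apply: pdvdB; [eexists | apply: pdvd_mull; exists c2].
  case/(lf_prime u0) => // -[f1' ->]; exists f1', f2.
  by congr (_ + _); rewrite /pscal /= !mulrA [lf u * f1']mulrC.
move=> f1 f2 E; have [|/eqP] := fr (f1 * lf u) f2.
  by rewrite -[RHS]E; congr (_ + _); rewrite /pscal /= !mulrA.
by rewrite mulf_eq0 (negPf lu0) orbF => /eqP.
Qed.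

(** The values of the quotients h1 and h2 at the zero P of u decide. They are not both zero, because
    of g0. If the generator of lower degree has nonzero value, a homogeneous multiple of it corrects
    the other generator to value zero, which is why the degrees are ordered first; if its value is
    zero, the other generator is the one multiplied by [lf u]. *)
Lemma gbasis_extend D u k th1 th2 d1 d2 : u != 0 ->
  (forall g, D g -> pdvd (lf u ^+ k) (act u g)) ->
  gbasis D th1 th2 -> submod D -> homog_pair d1 th1 -> homog_pair d2 th2 ->
  (exists g0 h0, [/\ D g0, act u g0 = lf u ^+ k * h0 & ~ pdvd (lf u) h0]) ->
  exists e1 e2 et1 et2,
    [/\ gbasis (fun g => D g /\ pdvd (lf u ^+ k.+1) (act u g)) et1 et2,
        homog_pair e1 et1, homog_pair e2 et2 & (e1 + e2 = (d1 + d2).+1)%N].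
Proof.
move=> u0 Dk B sD hth1 hth2 [g0 [h0 [Dg0 Eg0 nh0]]].
have [P P0 HP] := point1 u0.
have [y] := dot_eq1 P0; rewrite dotC => yP.
(* If d < k, the value at u has degree too small to be a nonzero multiple of [lf u ^+ k]; this is
   the alternative h = 0. *)
have Hh d th : D th -> homog_pair d th -> exists2 h, act u th = lf u ^+ k * h &
    ((k <= d)%N /\ h \is (d - k).-homog) \/ h = 0.
  move=> /Dk [c Ec] hd; have hc : lf u ^+ k * c \is d.-homog.
    by rewrite -Ec; apply: act_homog.
  case: (leqP k d) => kd.
    exists (pihomog mdeg (d - k) c); last by left; split=> //; apply: pihomogP.
    by rewrite Ec; apply: homog_quot (lfX_homog _ _) _; rewrite subnKC.
  exists 0; last by right.
  by rewrite mulr0 Ec; apply: homog_small (lfX_homog _ _) hc kd.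
have evP d h : ((k <= d)%N /\ h \is (d - k).-homog) \/ h = 0 ->
    (pdvd (lf u) h <-> h.@[fun j => P 0 j] = 0).
  case=> [[_ hh]|->]; first exact: lf_dvd_homogP P0 hh HP.
  by rewrite meval0; split=> // _; apply: pdvd0.
wlog le12 : d1 d2 th1 th2 B hth1 hth2 / (d1 <= d2)%N => [WL|].
  case: (leqP d1 d2) => [|/ltnW] le; first exact: WL hth1 hth2 le.
  have [e1 [e2 [et1 [et2 [B' he1 he2 E]]]]] := WL _ _ _ _ (gbasis_swap B) hth2 hth1 le.
  by exists e1, e2, et1, et2; split=> //; rewrite E addnC.
have [D1 D2 sp fr] := B.
have [h1 E1 H1] := Hh _ _ D1 hth1; have [h2 E2 H2] := Hh _ _ D2 hth2.
case: (eqVneq (h1.@[fun j => P 0 j]) 0) => [z1|n1].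
  have dv1 : pdvd (lf u) h1 by apply/(evP _ _ H1).
  case: (eqVneq (h2.@[fun j => P 0 j]) 0) => [z2|n2].
    case: nh0; have dv2 : pdvd (lf u) h2 by apply/(evP _ _ H2).
    have [f1 [f2 gE]] := sp _ Dg0; move: Eg0; rewrite gE actD !act_pscal E1 E2.
    move=> E; have -> : h0 = f1 * h1 + f2 * h2.
      have luk0 : lf u ^+ k != 0 by rewrite expf_neq0 // lf_eq0.
      by apply: (mulfI luk0); rewrite -E; ring.
    by apply: pdvdD; apply: pdvd_mull.
  have ndv2 : ~ pdvd (lf u) h2 by move/(evP _ _ H2)/eqP; rewrite (negPf n2).
  have B' := gbasis_step u0 Dk (gbasis_swap B) sD E2 E1 ndv2 dv1.
  exists (1 + d2)%N, d1, (pscal (lf u) th2), th1; split=> //; last by lia.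
  by apply: homog_pair_scal => //; apply: lf_homog.
have ndv1 : ~ pdvd (lf u) h1 by move/(evP _ _ H1)/eqP; rewrite (negPf n1).
have [kd1 hh1] : (k <= d1)%N /\ h1 \is (d1 - k).-homog.
  by case: H1 => // h10; case: ndv1; rewrite h10; apply: pdvd0.
(* The constant cancels the value of h2 at P. The form y has value 1 at P, so its power only adjusts
   the degree. *)
pose c := - (h2.@[fun j => P 0 j] / h1.@[fun j => P 0 j]).
pose f : S := c *: lf y ^+ (d2 - d1).
have hf : f \is (d2 - d1).-homog by apply: rpredZ; apply: lfX_homog.
have hth2' : homog_pair d2 (th2 + pscal f th1).
  apply: subspD => //; first exact: homog_pair_subsp.
  by have := homog_pair_scal hf hth1; rewrite subnK.
have B' := gbasis_shear f sD B.
have E2' : act u (th2 + pscal f th1) = lf u ^+ k * (h2 + f * h1).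
  by rewrite actD act_pscal E1 E2; ring.
have dv2 : pdvd (lf u) (h2 + f * h1).
  apply/(evP d2).
    left; split; first exact: leq_trans le12.
    have hfh : f * h1 \is (d2 - k).-homog.
      by have := dhomogM hf hh1; rewrite addnBA // subnK.
    apply: rpredD => //; case: H2 => [[]//|->]; exact: dhomog0.
  rewrite mevalD mevalM mevalZ rmorphXn /= lf_eval yP expr1n mulr1.
  by rewrite /c mulNr divfK // subrr.
exists (1 + d1)%N, d2, (pscal (lf u) th1), (th2 + pscal f th1); split=> //.
  exact: (gbasis_step u0 Dk B' sD E1 E2' ndv1 dv2).
by apply: homog_pair_scal => //; apply: lf_homog.
Qed.

Section Family.
Variables (I : finType) (v : I -> 'rV[K]_2).

Definition par i j := (v j <= v i)%MS && (v i <= v j)%MS.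

Definition multJ (J : {set I}) i : nat := #|[set j in J | par i j]|.

(* [D(B, k)] for the multiarrangement [B] of the lines [v i], [i] in [J], each
   counted with multiplicity. *)
Definition D2 (J : {set I}) (g : S * S) : Prop :=
  forall i, i \in J -> pdvd (lf (v i) ^+ multJ J i) (act (v i) g).

Lemma D2_submod J : submod (D2 J).
Proof.
split.
- by move=> i _; exists 0; rewrite /act /= !scaler0 addr0 mulr0.
- by move=> g g' Dg Dg' i iJ; rewrite actD; apply: pdvdD; auto.
- by move=> f g Dg i iJ; rewrite act_pscal; apply: pdvd_mull; auto.
Qed.

Lemma par_scale i j : v i != 0 -> v j != 0 -> par i j ->
  exists2 c, c != 0 & v j = c *: v i.
Proof.
move=> i0 j0 /andP [/sub_rVP [c E] _]; exists c => //.
by apply: contra_neq j0 => c0; rewrite E c0 scale0r.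
Qed.

Lemma par_refl i : par i i. Proof. by rewrite /par submx_refl. Qed.

Lemma par_sym i j : par i j = par j i. Proof. by rewrite /par andbC. Qed.

Lemma par_trans i j k : par i j -> par j k -> par i k.
Proof.
case/andP => h1 h2 /andP [h3 h4].
by rewrite /par (submx_trans h3 h1) (submx_trans h2 h4).
Qed.

Lemma par_pdvd i j k g : v i != 0 -> v j != 0 -> par i j ->
  pdvd (lf (v i) ^+ k) (act (v i) g) -> pdvd (lf (v j) ^+ k) (act (v j) g).
Proof.
move=> i0 j0 /(par_scale i0 j0) [c c0 ->] H.
by rewrite linearZ /= exprZn act_scale; apply/pdvd_scalel; [rewrite expf_neq0 | apply: pdvdZ].
Qed.

Lemma multJ_par J i j : par i j -> multJ J i = multJ J j.
Proof.
move=> ij; apply: eq_card => k; rewrite !inE; congr (_ && _).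
by apply/idP/idP; apply: par_trans => //; rewrite par_sym.
Qed.

Lemma multJ_add (J : {set I}) i j : i \notin J -> multJ (i |: J) j = (par j i + multJ J j)%N.
Proof.
move=> iJ; rewrite /multJ.
have -> : [set k in i |: J | par j k] =
    if par j i then i |: [set k in J | par j k] else [set k in J | par j k].
  apply/setP => k; case: ifP => ji; rewrite !inE; case: eqVneq => // ->; rewrite ?ji //.
  by rewrite (negPf iJ).
by case: ifP => // _; rewrite cardsU1 !inE (negPf iJ).
Qed.

(** Adding i raises the exponent at every line parallel to i, but the conditions at parallel lines
    are equivalent, so only one new condition appears. *)
Lemma D2_add (J : {set I}) i g : (forall j, j \in i |: J -> v j != 0) -> i \notin J ->
  D2 (i |: J) g <-> D2 J g /\ pdvd (lf (v i) ^+ (multJ J i).+1) (act (v i) g).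
Proof.
move=> v0 iJ; split=> [Dg|[Dg Di] j].
  have Di : pdvd (lf (v i) ^+ (multJ J i).+1) (act (v i) g).
    by have := Dg i (setU11 _ _); rewrite multJ_add // par_refl.
  split=> // j jJ; have := Dg j (setU1r i jJ); rewrite multJ_add //.
  apply: pdvd_trans; rewrite exprD; apply: pdvd_mull; exact: pdvd_refl.
rewrite in_setU1 multJ_add // => /predU1P [->|jJ]; first by rewrite par_refl.
case ji : (par j i); last exact: Dg.
rewrite (multJ_par J ji); apply: (@par_pdvd i j) => //; last by rewrite par_sym.
  by rewrite v0 ?setU11.
by rewrite v0 ?setU1r.
Qed.

Lemma D2_basis (J : {set I}) : (forall j, j \in J -> v j != 0) ->
  exists d1 d2 th1 th2, [/\ gbasis (D2 J) th1 th2,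
    homog_pair d1 th1, homog_pair d2 th2 & (d1 + d2 = #|J|)%N].
Proof.
move: {2}#|J| (erefl #|J|) => m; elim: m J => [|m IH] J.
  move=> /cards0_eq -> _; exists 0%N, 0%N, (1, 0), (0, 1); split.
  - split=> [i|i|g _|f1 f2]; rewrite ?inE //.
      by exists g.1, g.2; case: g => a b; congr pair; rewrite /= ?mulr1 ?mulr0 ?addr0 ?add0r.
    by move=> E; move: (congr1 fst E) (congr1 snd E); rewrite /= !mulr1 !mulr0 addr0 add0r.
  - by split; [apply: dhomog1 | apply: dhomog0].
  - by split; [apply: dhomog0 | apply: dhomog1].
  - by rewrite cards0.
move=> cJ v0; have /card_gt0P [i iJ] : (0 < #|J|)%N by rewrite cJ.
have i0 := v0 _ iJ.
have v0' j : j \in J :\ i -> v j != 0 by rewrite inE => /andP [_ /v0].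
have cJ' : #|J :\ i| = m by move: cJ; rewrite (cardsD1 i) iJ => -[].
have nJ' : i \notin J :\ i by rewrite !inE eqxx.
have [d1 [d2 [th1 [th2 [B h1 h2 E]]]]] := IH _ cJ' v0'.
(* The exponent is positive only if a line parallel to i remains, and its condition then transfers
   to i. *)
have Dk g : D2 (J :\ i) g -> pdvd (lf (v i) ^+ multJ (J :\ i) i) (act (v i) g).
  case: (posnP (multJ (J :\ i) i)) => [-> _|/card_gt0P [j]].
    by exists (act (v i) g); rewrite mul1r.
  rewrite inE => /andP [jJ ij] Dg'.
  by rewrite (multJ_par _ ij); apply: (@par_pdvd j i); [exact: v0' | | rewrite par_sym | apply: Dg'].
have [|e1 [e2 [et1 [et2 [B' h1' h2' E']]]]] :=
    gbasis_extend i0 Dk B (D2_submod _) h1 h2.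
  (* a constant field transversal to [v i], times the other lines *)
  have [c ci] := const_field 2 i0.
  pose q : S := \prod_(j <- enum [set j in J | ~~ par i j]) lf (v j) ^+ multJ (J :\ i) j.
  exists (pscal (lf (v i) ^+ multJ (J :\ i) i * q) c), q; split.
  - move=> j; rewrite !inE => /andP [ji jJ]; rewrite act_pscal.
    case ij : (par i j).
      have [a a0 vj] := par_scale i0 (v0 _ jJ) ij.
      rewrite -(multJ_par _ ij) {1}vj linearZ /= exprZn.
      apply/pdvd_scalel; first by rewrite expf_neq0.
      by rewrite -!mulrA; eexists.
    rewrite -mulrA; apply: pdvd_mull; apply: pdvd_mulr.
    rewrite /q (bigD1_seq j) ?enum_uniq ?mem_enum ?inE ?jJ ?ij //=.
    by eexists.
  - by rewrite act_pscal ci mulr1.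
  rewrite /q => /(lf_prime_prod i0) [j]; rewrite mem_enum inE => /andP [jJ nij].
  elim: (multJ _ j) => [|k IHk]; first by rewrite expr0 => /(lf_dvd1 i0).
  rewrite exprS => /(lf_prime i0) [|//] /(lf_dvd_lf i0) ji.
  case/negP: nij; rewrite /par ji /=.
  have /sub_rVP [a va] := ji; have a0 : a != 0.
    by apply: contra_neq (v0 _ jJ) => a0; rewrite va a0 scale0r.
  by rewrite va; apply/sub_rVP; exists a^-1; rewrite scalerA mulVf // scale1r.
exists e1, e2, et1, et2; split=> //; last by rewrite E' E cJ' cJ.
case: B' => D1 D2' sp fr.
have DE g : D2 J g <-> D2 (J :\ i) g /\
    pdvd (lf (v i) ^+ (multJ (J :\ i) i).+1) (act (v i) g).
  by rewrite -[in D2 J g](setD1K iJ); apply: D2_add; rewrite ?(setD1K iJ).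
split=> //; [exact/DE | exact/DE |].
by move=> g /DE /sp.
Qed.

End Family.

Lemma gbasis_dim (D : S * S -> Prop) th1 th2 d1 d2 N :
  submod D -> gbasis D th1 th2 -> homog_pair d1 th1 -> homog_pair d2 th2 ->
  codim (fun g => D g /\ homog_pair N g) (fun g => g = 0)
    ((N.+1 - d1) + (N.+1 - d2)).
Proof.
move=> sD [D1 D2' sp fr] h1 h2; have [D0 DD DM] := sD.
(* Coefficients of a generator of degree d have degree N - d. For d > N they must vanish, whereas
   the truncated difference would admit constants. *)
pose hs d (p : S) := if (d <= N)%N then p \is (N - d).-homog : Prop else p = 0.
have shs d : subsp (hs d).
  rewrite /hs; case: leqP => _; [exact: homog_subsp | exact: eq0_subsp].
have hs0 d p : p = 0 -> hs d p by move->; case: (shs d).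
have cd d : codim (hs d) (fun p => p = 0) (N.+1 - d).
  rewrite /hs; case: leqP => dN; first by rewrite subSn //; apply: codim_homog2.
  by have -> : (N.+1 - d = 0)%N; [apply/eqP; rewrite subn_eq0 | apply: codim_self].
have hsM d p th : hs d p -> homog_pair d th -> homog_pair N (pscal p th).
  rewrite /hs; case: leqP => dN hp hth.
    by have := homog_pair_scal hp hth; rewrite subnK.
  by rewrite hp; split; rewrite /= mul0r; apply: dhomog0.
have piM d p th : homog_pair d th -> exists2 p', hs d p' &
    (pihomog mdeg N (p * th.1), pihomog mdeg N (p * th.2)) = pscal p' th.
  move=> [ha hb]; exists (if (d <= N)%N then pihomog mdeg (N - d) p else 0).
    by rewrite /hs; case: leqP => // _; apply: pihomogP.
  rewrite /pscal ![p * _]mulrC (pihomogMl _ _ ha) (pihomogMl _ _ hb).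
  by case: leqP; rewrite ?mul0r // ![_ * pihomog _ _ _]mulrC.
have := codim_pair (shs d1) (@eq0_subsp _ _) (shs d2) (@eq0_subsp _ _) (hs0 d1) (hs0 d2) (cd d1) (cd d2).
apply: (codim_rel (R := fun f g => g = pscal f.1 th1 + pscal f.2 th2)).
- split=> [|c u w [??] [??]]; first by split; apply: hs0.
  by split; apply: (proj2 (shs _)).
- by apply: subspI; [apply: submod_subsp | apply: homog_pair_subsp].
- by congr pair; rewrite /= !mul0r addr0.
- move=> c u w g g' -> ->; congr pair; rewrite /= scalerDr !mulrDl -!scalerAl; ring.
- move=> f [f1 f2]; exists (pscal f.1 th1 + pscal f.2 th2); split=> //; split.
    by apply: DD; apply: DM.
  by apply: subspD; [apply: homog_pair_subsp | apply: (hsM d1) | apply: (hsM d2)].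
- move=> g [/sp [f1 [f2 gE]] [hg1 hg2]].
  have [p1 hp1 E1] := piM _ f1 _ h1; have [p2 hp2 E2] := piM _ f2 _ h2.
  exists (p1, p2); split=> //=; rewrite -E1 -E2; move: hg1 hg2.
  rewrite gE => /pihomog_dE hg1 /pihomog_dE hg2.
  by congr pair; rewrite /= -pihomogD ?hg1 ?hg2.
move=> f g _ _ ->; split=> [[-> ->]|/fr //].
by congr pair; rewrite /= !mul0r addr0.
Qed.

Lemma codim_homog_pair N :
  codim (@homog_pair 2 N) (fun g => g = 0) (N.+1 + N.+1).
Proof.
have hz (p : S) : p = 0 -> p \is N.-homog by move->; apply: dhomog0.
have := codim_pair (homog_subsp _ _ _) (@eq0_subsp _ _) (homog_subsp _ _ _)
  (@eq0_subsp _ _) hz hz (codim_homog2 K N) (codim_homog2 K N).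
apply: codim_ext => // -[a b] /=; split=> [[-> ->]//|[-> ->]//].
Qed.

Lemma gbasis_codim (D : S * S -> Prop) th1 th2 d1 d2 N :
  submod D -> gbasis D th1 th2 -> homog_pair d1 th1 -> homog_pair d2 th2 ->
  exists2 q, codim (@homog_pair 2 N) (fun g => D g /\ homog_pair N g) q &
    (q + ((N.+1 - d1) + (N.+1 - d2)) = N.+1 + N.+1)%N.
Proof.
move=> sD B h1 h2.
have sDN : subsp (fun g => D g /\ homog_pair N g).
  by apply: subspI; [apply: submod_subsp | apply: homog_pair_subsp].
have z g : g = 0 -> D g /\ homog_pair N g by move->; case: sDN.
have [|b [c [cb cc E]]] := codim_mid (homog_pair_subsp 2 N) sDN (@eq0_subsp _ _) _ z (codim_homog_pair N).
  by move=> g [].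
exists b => //; rewrite E; congr (_ + _)%N.
by apply: (codim_uniq sDN (@eq0_subsp _ _) z (gbasis_dim N sD B h1 h2) cc).
Qed.

End PlaneMulti.

(** * Adding a line *)

(** One representative per fibre, chosen by a [pick] that depends only on the value of f. It will
    select one line through each affine point of a given line. *)
Lemma exists_reps (I T : finType) (f : I -> T) (J : {set I}) :
  exists R : {set I}, [/\ R \subset J, {in R &, injective f},
    forall j, j \in J -> exists2 r, r \in R & f r = f j & #|R| = #|f @: J|].
Proof.
pose pk j := [pick k in J | f k == f j].
pose R := [set j in J | pk j == Some j].
have pkE j k : f j = f k -> pk j = pk k by move=> E; rewrite /pk E.
have sR : R \subset J by apply/subsetP => j; rewrite inE => /andP [].
have iR : {in R &, injective f}.
  move=> i j; rewrite !inE => /andP [_ /eqP Ei] /andP [_ /eqP Ej] /pkE E.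
  by move: E; rewrite Ei Ej => -[].
have cR j : j \in J -> exists2 r, r \in R & f r = f j.
  move=> jJ; case E : (pk j) => [k|]; last first.
    by move: E; rewrite /pk; case: pickP => // /(_ j); rewrite jJ eqxx.
  have [multJ kj] : k \in J /\ f k = f j.
    by move: E; rewrite /pk; case: pickP => // k' /andP [multJ /eqP kj] [<-].
  by exists k => //; rewrite inE multJ (pkE _ _ kj) E eqxx.
exists R; split=> //; rewrite -(card_in_imset iR); congr #|pred_of_set _|.
apply/setP => y; apply/imsetP/imsetP => [[r rR ->]|[j /cR [r rR <-] ->]]; last by exists r.
by exists r => //; apply: (subsetP sR).
Qed.

Section Step.
Variables (K : fieldType) (I : finType) (a : I -> 'rV[K]_3) (h : I).
Hypothesis a_h : a h = delta_mx 0 0.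
Hypothesis a0 : forall i, a i != 0.
Hypothesis an : forall i j, i != j -> ~~ (a i <= a j)%MS.
Local Notation S := {mpoly K[3]}.
Local Notation re i := (resvec (a i)).

Lemma resvecP c (u v : 'rV[K]_3) : resvec (c *: u + v) = c *: resvec u + resvec v.
Proof. by apply/rowP => j; rewrite !mxE. Qed.

Lemma resvecZ c (u : 'rV[K]_3) : resvec (c *: u) = c *: resvec u.
Proof. by apply/rowP => j; rewrite !mxE. Qed.

Lemma resvec_eq0 (u : 'rV[K]_3) : resvec u = 0 -> u = u 0 0 *: delta_mx 0 0.
Proof.
move=> E; apply/rowP => j; rewrite !mxE eqxx /=.
case: (unliftP ord0 j) => [k|] ->; last by rewrite eqxx mulr1.
by have := congr1 (fun M : 'rV_2 => M 0 k) E; rewrite !mxE /= mulr0.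
Qed.

Lemma re_neq0 i : i != h -> re i != 0.
Proof.
move=> ih; apply: contraNneq (an ih) => /resvec_eq0 ->.
by rewrite a_h; apply: scalemx_sub.
Qed.

Lemma actDu n (u v : 'rV[K]_2) (g : {mpoly K[n]} * {mpoly K[n]}) :
  act (u + v) g = act u g + act v g.
Proof. by rewrite /act !mxE !scalerDl; ring. Qed.

(** For distinct i and j, all lines through their common point, that is, the rank-two flat they
    span. The point is affine when h is not a member. The lock keeps simplification from unfolding
    membership. *)
Definition cl i j : {set I} := locked [set k | (a k <= a i + a j)%MS].

Lemma in_cl i j k : (k \in cl i j) = (a k <= a i + a j)%MS.
Proof. by rewrite /cl -lock inE. Qed.

(* The derivations [g.1 d/dz_2 + g.2 d/dz_3] logarithmic along [J]. *)
Definition D3 (J : {set I}) (g : S * S) : Prop :=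
  forall j, j \in J -> pdvd (lf (a j)) (act (re j) g).

Lemma D3_subsp J : subsp (D3 J).
Proof.
split=> [j _|c u v Du Dv j jJ].
  by rewrite /act /= !scaler0 addr0; apply: pdvd0.
by rewrite actD actZ; apply: pdvdD; [apply: pdvdZ; apply: Du | apply: Dv].
Qed.

Lemma D3_pscal J f g : D3 J g -> D3 J (pscal f g).
Proof. by move=> Dg j jJ; rewrite act_pscal; apply: pdvd_mull; apply: Dg. Qed.

Lemma D3_add J i g : D3 (i |: J) g <-> D3 J g /\ pdvd (lf (a i)) (act (re i) g).
Proof.
split=> [D|[D Di] j]; last by rewrite in_setU1 => /predU1P [->|/D].
by split=> [j jJ|]; apply: D; rewrite ?setU11 // setU1r.
Qed.

Definition pipair n d (g : {mpoly K[n]} * {mpoly K[n]}) :=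
  (pihomog mdeg d g.1, pihomog mdeg d g.2).

Lemma act_pipair n d u (g : {mpoly K[n]} * {mpoly K[n]}) :
  act u (pipair d g) = pihomog mdeg d (act u g).
Proof. by rewrite /act /= pihomogD !linearZ. Qed.

Lemma pipair_homog n d (g : {mpoly K[n]} * {mpoly K[n]}) : homog_pair d (pipair d g).
Proof. by split; apply: pihomogP. Qed.

Lemma D3_pipair J d g : D3 J g -> D3 J (pipair d g).
Proof.
by move=> D j jJ; rewrite act_pipair; apply: pdvd_pihomog (lf_homog _) _; apply: D.
Qed.

Section Line.
Variable l : I.
Hypothesis lh : l != h.

Lemma cl_exchange j k : j != l -> k != l -> k \in cl l j -> (a l + a k :=: a l + a j)%MS.
Proof.
move=> jl kl; rewrite in_cl => kj; apply/eqmxP.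
have s1 : (a l + a k <= a l + a j)%MS by rewrite addsmx_sub addsmxSl.
have := mxrank_leqif_eq s1; rewrite !rank_adds_rV ?a0 ?an //.
by case=> _; rewrite eqxx => <-.
Qed.

Lemma cl_eq j k : j != l -> k != l -> k \in cl l j -> cl l k = cl l j.
Proof.
by move=> jl kl /(cl_exchange jl kl) E; apply/setP => i; rewrite !in_cl E.
Qed.

Lemma mem_cl j : j \in cl l j. Proof. by rewrite in_cl addsmxSr. Qed.

Lemma cl_decomp j k : j != k -> k != l -> k \in cl l j ->
  exists s t, s != 0 /\ a k = s *: a l + t *: a j.
Proof.
move=> jk kl; rewrite in_cl => /sub_addsmxP [[y z] /= E].
have [s sE] : exists s, y *m a l = s *: a l by apply/sub_rVP; apply: submxMl.
have [t tE] : exists t, z *m a j = t *: a j by apply/sub_rVP; apply: submxMl.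
exists s, t; rewrite E sE tE; split=> //.
have kj : k != j by rewrite eq_sym.
apply: contraNneq (an kj) => s0.
by rewrite E sE tE s0 scale0r add0r; apply: scalemx_sub.
Qed.

(** Lines that meet on H are parallel in the affine plane: in the linear relation between the three
    forms, the form of H vanishes on restriction to H. *)
Lemma cl_h_par j : j != h -> j != l -> h \in cl l j ->
  exists2 t, t != 0 & re j = t *: re l.
Proof.
move=> jh jl hj; have hl : h != l by rewrite eq_sym.
have [s [t [s0 E]]] := cl_decomp jh hl hj.
have t0 : t != 0.
  apply: contraNneq (an hl) => t0.
  by rewrite E t0 scale0r addr0; apply: scalemx_sub.
have E' : s *: re l + t *: re j = 0.
  have : resvec (a h) = 0 by rewrite a_h; apply/rowP => i; rewrite !mxE.
  by rewrite E resvecP resvecZ.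
exists (- (s / t)); first by rewrite oppr_eq0 mulf_neq0 // invr_eq0.
apply: (scalerI t0); rewrite scalerA mulrN mulrCA mulfV // mulr1 scaleNr.
by apply/eqP; rewrite -addr_eq0 addrC E'.
Qed.

Lemma det2_eq0 (u w : 'rV[K]_2) : u != 0 -> u 0 0 * w 0 1 - u 0 1 * w 0 0 = 0 ->
  exists t, w = t *: u.
Proof.
move=> u0 /eqP; rewrite subr_eq0 => /eqP d0.
have i01 (i : 'I_2) : i = 0 \/ i = 1.
  by case: i => [[|[|]]] // hi; [left | right]; apply: val_inj.
case/rV0Pn: u0 => k; case: (i01 k) => -> n0.
  exists (w 0 0 / u 0 0); apply/rowP => i; rewrite mxE.
  case: (i01 i) => ->; first by rewrite divfK.
  by apply: (mulfI n0); rewrite d0; field.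
exists (w 0 1 / u 0 1); apply/rowP => i; rewrite mxE.
case: (i01 i) => ->; last by rewrite divfK.
by apply: (mulfI n0); rewrite -d0; field.
Qed.

(** If the restrictions to H were proportional, some combination of the two forms would be a nonzero
    multiple of the form of H, and the lines would meet on H. *)
Lemma cl_det j : j != l -> h \notin cl l j ->
  re l 0 0 * re j 0 1 - re l 0 1 * re j 0 0 != 0.
Proof.
move=> jl; apply: contraNneq => /(det2_eq0 (re_neq0 lh)) [t tE].
have : resvec (- t *: a l + a j) = 0 by rewrite resvecP tE scaleNr addNr.
move/resvec_eq0; rewrite -a_h; set c := _ 0 0 => E.
have c0 : c != 0.
  apply: contraNneq (an jl) => c0; move: E; rewrite c0 scale0r scaleNr addrC => /eqP.
  by rewrite subr_eq0 => /eqP ->; apply: scalemx_sub.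
rewrite in_cl -(scale1r (a h)) -(mulVf c0) -scalerA -E.
apply: scalemx_sub; apply: addmx_sub; last exact: addsmxSr.
by apply: submx_trans (scalemx_sub _ _) (addsmxSl _ _).
Qed.

Definition prodl (T : {set I}) : S := \prod_(b in T) lf (a b).

Lemma prodl_homog T : prodl T \is #|T|.-homog.
Proof. by rewrite /prodl -big_enum cardE; apply: lf_prod_homog. Qed.

Lemma prodl_dvd_l (T : {set I}) c :
  l \notin T -> pdvd (lf (a l)) (prodl T * c) -> pdvd (lf (a l)) c.
Proof.
move=> lT /(lf_prime (a0 l)) [|//]; rewrite /prodl -big_enum.
case/(lf_prime_prod (a0 l)) => i; rewrite mem_enum => iT /(lf_dvd_lf (a0 l)).
by rewrite (negPf (an _)) //; apply: contraNneq lT => <-.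
Qed.

(** Divisibility of u by q on the line l, that is, modulo [lf (a l)]. *)
Definition mod2 (q u : S) : Prop := exists c w, u = lf (a l) * c + q * w.

(** Coprime divisors on the line l can be multiplied. The lines of T may all cut l in the same
    point, so their product can be a repeated factor there; hence they are split off one at a time,
    each being prime on l and not dividing s. *)
Lemma mod2_combine (s : S) (T : seq I) u :
  l \notin T ->
  (forall b, b \in T -> ~ ideal2 (a l) (a b) s) ->
  mod2 s u -> mod2 (\prod_(b <- T) lf (a b)) u ->
  mod2 (s * \prod_(b <- T) lf (a b)) u.
Proof.
move=> + + Hs; elim: T => [|b T IH] lT nT; first by rewrite big_nil mulr1.
rewrite big_cons => -[c' [w' E']].
move: lT; rewrite in_cons negb_or => /andP [lb lT].
set F := \prod_(j <- T) lf (a j) in E' *.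
have [|||c [w E]] := IH => //.
- by move=> b' b'T; apply: nT; rewrite in_cons b'T orbT.
- by exists c', (lf (a b) * w'); rewrite E' -/F; ring.
(* The two expressions of u agree, and F can be cancelled modulo [lf (a l)]. Then s w lies in the
   prime ideal of the point on l and b, which does not contain s, so w lies in it and supplies the
   missing factor. *)
have Fl : pdvd (lf (a l)) (s * w - lf (a b) * w').
  have : pdvd (lf (a l)) (F * (s * w - lf (a b) * w')).
    exists (c' - c); rewrite -/F in E.
    have -> : F * (s * w - lf (a b) * w') = s * F * w - lf (a b) * F * w' by ring.
    have -> : s * F * w = u - lf (a l) * c by rewrite E; ring.
    have -> : lf (a b) * F * w' = u - lf (a l) * c' by rewrite E'; ring.
    by ring.
  case/(lf_prime (a0 l)) => //; case/(lf_prime_prod (a0 l)) => i iT /(lf_dvd_lf (a0 l)).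
  by rewrite (negPf (an _)) //; apply: contraNneq lT => <-.
have bl : b != l by rewrite eq_sym.
have [P P0 HP] := point2 (a0 l) (an bl).
have [y] := dot_eq1 P0; rewrite dotC => yP.
have /(ideal2_evpP _ yP HP) : ideal2 (a l) (a b) (s * w).
  case: Fl => x xE; exists x, w'; rewrite -xE; ring.
rewrite evpM => /eqP; rewrite mulf_eq0 => /orP [/eqP|/eqP] /(ideal2_evpP _ yP HP).
  by move/nT => []; rewrite mem_head.
case=> x [z wE]; exists (c + s * F * x), z; rewrite E wE -/F; ring.
Qed.

Variable J : {set I}.
Hypothesis lJ : l \notin J.
Hypothesis hJ : h \notin J.

Let Jl j : j \in J -> j != l. Proof. by move=> jJ; apply: contraNneq lJ => <-. Qed.
Let Jh j : j \in J -> j != h. Proof. by move=> jJ; apply: contraNneq hJ => <-. Qed.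

(* Subtracting a multiple of the Euler field at the point [P] where [a l] and
   [a r] meet, we get [g'] killed by [a r] with the same value at [a l] modulo
   [a l]; all lines of [J] through [P] but [a r] divide that value. *)
Lemma D3_class g r : D3 J g -> r \in J -> h \notin cl l r ->
  mod2 (prodl [set b in J :\ r | b \in cl l r]) (act (re l) g).
Proof.
move=> Dg rJ hr; set T := [set _ in _ | _].
have rl := Jl rJ.
have [P P0 HP] := point2 (a0 l) (an rl).
have P00 : P 0 0 != 0.
  apply: contraNneq hr => P00; rewrite in_cl; apply/HP.
  by rewrite a_h dotC dot_delta.
(* The Euler field centred at P in the affine chart off H, made homogeneous. It sends [lf v] to
   itself for every line v through P. *)
pose th : S * S := ('X_(lift ord0 0) - (P 0 (lift ord0 0) / P 0 0) *: 'X_0,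
                    'X_(lift ord0 1) - (P 0 (lift ord0 1) / P 0 0) *: 'X_0).
have thE (v : 'rV[K]_3) : dot v P = 0 -> act (resvec v) th = lf v.
  rewrite /dot /lf !big_ord_recl !big_ord0 !addr0.
  rewrite (_ : lift ord0 (lift ord0 ord0) = lift ord0 1); last exact: val_inj.
  rewrite (_ : lift ord0 ord0 = lift ord0 0); last exact: val_inj.
  set x := lift ord0 0; set y := lift ord0 1; rewrite (_ : ord0 = 0) // => vP.
  have v00 : v 0 0 = - (v 0 x * (P 0 x / P 0 0) + v 0 y * (P 0 y / P 0 0)).
    apply: (mulIf P00); rewrite mulNr mulrDl -!mulrA mulVf // !mulr1.
    by apply/eqP; rewrite -addr_eq0 vP.
  rewrite v00 /th /act /= !mxE -/x -/y -!mul_mpolyC mpolyCN mpolyCD !mpolyCM.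
  by ring.
have [q qE] := Dg r rJ.
pose g' := g - pscal q th.
have gE : g = g' + pscal q th by rewrite subrK.
have rP : dot (a r) P = 0 by apply/HP; apply: addsmxSr.
have lP : dot (a l) P = 0 by apply/HP; apply: addsmxSl.
have r0 : act (re r) g' = 0.
  apply: (addIr (act (re r) (pscal q th))); rewrite -actD -gE add0r.
  by rewrite act_pscal thE // qE mulrC.
have [w wE] : pdvd (\prod_(b <- enum T) lf (a b)) (act (re l) g').
  apply: lf_prod_dvd => [|i _|i j _ _|b]; [exact: enum_uniq | exact: a0 | exact: an |].
  rewrite mem_enum !inE => /andP [/andP [br bJ] bcl].
  have rb : r != b by rewrite eq_sym.
  have [s [t [s0 bE]]] := cl_decomp rb (Jl bJ) bcl.
  have bP : dot (a b) P = 0 by apply/HP; rewrite -in_cl.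
  have Hb : act (re b) g' = s *: act (re l) g'.
    by rewrite bE resvecP resvecZ actDu !act_scale r0 scaler0 addr0.
  have : pdvd (lf (a b)) (act (re b) g').
    have -> : act (re b) g' = act (re b) g - q * lf (a b).
      by rewrite gE actD act_pscal thE // addrK.
    by apply: pdvdB; [apply: Dg | apply: pdvd_mull; apply: pdvd_refl].
  by rewrite Hb => /(pdvdZ s^-1); rewrite scalerA mulVf // scale1r.
exists q, w; rewrite gE actD act_pscal thE // wE /prodl -big_enum; ring.
Qed.

(** A line that meets l on H has, up to a scalar, the same restriction as l, so its condition bears
    directly on the value at l. This is divisibility in the full ring, not just on l. *)
Lemma D3_parallel g : D3 J g ->
  pdvd (prodl [set b in J | h \in cl l b]) (act (re l) g).
Proof.
move=> Dg; rewrite /prodl -big_enum; apply: lf_prod_dvd; rewrite ?enum_uniq //.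
  by move=> i j _ _; apply: an.
move=> b; rewrite mem_enum inE => /andP [bJ hb].
have [t t0 tE] := cl_h_par (Jh bJ) (Jl bJ) hb.
have := Dg b bJ; rewrite tE act_scale => /(pdvdZ t^-1).
by rewrite scalerA mulVf // scale1r.
Qed.

Lemma prodl_not_ideal2 (T : {set I}) b : b != l -> (forall j, j \in T -> j \notin cl l b) ->
  ~ ideal2 (a l) (a b) (prodl T).
Proof.
move=> bl nT; have [P P0 HP] := point2 (a0 l) (an bl).
move/(ideal2_homogP P0 (prodl_homog T) HP); rewrite rmorph_prod /= => /eqP.
case/prodf_eq0 => j /nT nj; rewrite lf_eval => /eqP /HP jl.
by move: nj; rewrite in_cl jl.
Qed.

Variable R : {set I}.
Hypothesis sR : R \subset [set j in J | h \notin cl l j].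
Hypothesis iR : {in R &, injective (cl l)}.
Hypothesis cR : forall j, j \in J -> h \notin cl l j -> exists2 r, r \in R & cl l r = cl l j.

Let RJ r : r \in R -> r \in J.
Proof. by move/(subsetP sR); rewrite inE => /andP []. Qed.
Let Rh r : r \in R -> h \notin cl l r.
Proof. by move/(subsetP sR); rewrite inE => /andP []. Qed.

(** R contains one line through each affine point of l on J, so a point lying on k lines of J
    contributes k - 1 factors, while all lines parallel to l contribute. The factors at distinct
    points are coprime on l, and the points are added one by one. *)
Lemma D3_value g : D3 J g -> mod2 (prodl (J :\: R)) (act (re l) g).
Proof.
move=> Dg.
(* The lines outside R that are parallel to l or pass through a point represented in s. *)
pose U (s : seq I) := [set b in J :\: R | (h \in cl l b) || has (fun r => cl l r == cl l b) s].
have H s : {subset s <= R} -> mod2 (prodl (U s)) (act (re l) g).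
  elim: s => [|r s IH] sub.
    have -> : U [::] = [set b in J | h \in cl l b].
      apply/setP => b; rewrite !inE orbF; case bR : (b \in R) => //=.
      by rewrite (negPf (Rh bR)) andbF.
    by have [w ->] := D3_parallel Dg; exists 0, w; rewrite mulr0 add0r.
  have rR : r \in R by apply: sub; rewrite mem_head.
  have {}IH : mod2 (prodl (U s)) (act (re l) g).
    by apply: IH => j js; apply: sub; rewrite in_cons js orbT.
  case rs : (has (fun r' => cl l r' == cl l r) s).
    have -> : U (r :: s) = U s => //; apply/setP => b; rewrite !inE /=.
    case: eqVneq => [<-|]; last by [].
    by rewrite rs.
  pose T := [set b in J :\ r | b \in cl l r].
  have TJ b : b \in T -> b \in J by rewrite !inE => /andP [/andP []].
  have Tl b : b \in T -> b != l by move/TJ/Jl.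
  have Tcl b : b \in T -> cl l b = cl l r.
    move=> bT; apply: cl_eq (Tl _ bT) _; first exact/Jl/RJ.
    by move: bT; rewrite in_set => /andP [].
  have UE : U (r :: s) = U s :|: T.
    apply/setP => b; rewrite !inE /=.
    case bJ : (b \in J); rewrite ?andbF ?orbF //= ?andbT.
    case: (boolP (b \in R)) => bR /=.
      case: eqVneq => //= br; apply/esym; apply/negP => bcl.
      have E := cl_eq (Jl (RJ rR)) (Jl bJ) bcl.
      by rewrite (iR bR rR E) eqxx in br.
    have br : b != r by apply: contraNneq bR => ->.
    rewrite br /=; case: eqVneq => [E|nE].
      by rewrite E mem_cl !orbT.
    case: (boolP (b \in cl l r)) => bcl; last by rewrite orbF.
    by rewrite (cl_eq (Jl (RJ rR)) (Jl bJ) bcl) eqxx in nE.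
  have dUT : [disjoint U s & T].
    rewrite disjoint_subset; apply/subsetP => b; rewrite in_set => /andP [_ Hb].
    rewrite inE; apply/negP => /Tcl E.
    by move: Hb; rewrite E rs orbF (negPf (Rh rR)).
  rewrite UE /prodl (eq_bigl [predU U s & T]); last by move=> b; rewrite !inE.
  rewrite bigU //= -!/(prodl _) -[prodl T]big_enum.
  apply: mod2_combine => //.
  - by rewrite mem_enum; apply/negP => /Tl; rewrite eqxx.
  - move=> b; rewrite mem_enum => bT; apply: prodl_not_ideal2; first exact: Tl.
    move=> j jU; apply/negP => jb.
    have jJ : j \in J by move: jU; rewrite !inE => /andP [/andP []].
    have E : cl l j = cl l r by rewrite -(Tcl b bT); apply: cl_eq (Tl _ bT) (Jl jJ) jb.
    by move: jU; rewrite in_set E rs orbF (negPf (Rh rR)) andbF.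
  - by rewrite big_enum; apply: D3_class => //; [apply: RJ | apply: Rh].
have := H (enum R); have -> : U (enum R) = J :\: R.
  apply/setP => b; rewrite in_set; case: (boolP (b \in J :\: R)) => //=.
  rewrite in_setD => /andP [bR bJ]; case: (boolP (h \in cl l b)) => //= hb.
  have [r rR rE] := cR bJ hb.
  by apply/hasP; exists r; rewrite ?mem_enum // rE.
by apply=> r; rewrite mem_enum.
Qed.

(** Interpolation on the line l at the points cut out by s: subtracting a multiple of the product of
    the other lines makes p vanish at the first point, and what remains is [lf (a r)] times a form
    of lower degree modulo [lf (a l)]. The factor [lf (a r)] is absorbed into C. The bound on the
    size of s keeps the degree sufficient down to the last point. *)
Lemma lagrange_ideal (X : S -> Prop) (C : S) (s : seq I) e p :
  ideal X -> (forall q, X (lf (a l) * q)) -> uniq s -> s != [::] ->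
  (forall r, r \in s -> r != l) ->
  (forall r r', r \in s -> r' \in s -> r != r' -> r' \notin cl l r) ->
  (forall r, r \in s -> X (C * \prod_(r' <- s | r' != r) lf (a r'))) ->
  p \is e.-homog -> (size s <= e.+1)%N -> X (C * p).
Proof.
move=> iX Xl; have [X0 XD XM] := iX.
elim: s C e p => [//|r s IH] C e p /= /andP [rs us] _ sl scl HX hp se.
have hr : X (C * \prod_(r' <- s) lf (a r')).
  have := HX r (mem_head _ _); rewrite big_cons eqxx /= big_seq_cond.
  rewrite (eq_bigl (fun i => i \in s)) -?big_seq // => i.
  by case is_ : (i \in s) => //=; apply: contraNneq rs => <-.
case: (eqVneq s [::]) => [s0|sn].
  by move: hr; rewrite s0 big_nil mulr1 => H; rewrite mulrC; apply: XM.
have e0 : (0 < e)%N by rewrite -ltnS (leq_trans _ se) //= ltnS lt0n size_eq0.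
set Q := \prod_(r' <- s) _ in hr.
have rl : r != l by apply: sl; rewrite mem_head.
have [P P0 HP] := point2 (a0 l) (an rl).
have [y] := dot_eq1 P0; rewrite dotC => yP.
have QP : Q.@[fun j => P 0 j] != 0.
  rewrite /Q rmorph_prod /= prodf_seq_neq0; apply/allP => j js /=.
  have js' : j \in r :: s by rewrite in_cons js orbT.
  have rj : r != j by apply: contraNneq rs => ->.
  rewrite lf_eval; apply: contraNneq (scl r j (mem_head _ _) js' rj).
  by move/HP; rewrite in_cl.
(* The Lagrange coefficient at P; since y has value 1 at P, its power merely fills up the degree. *)
pose c := p.@[fun j => P 0 j] / Q.@[fun j => P 0 j].
pose p' := p - c *: (Q * lf y ^+ (e - size s)).
have hQ : Q * lf y ^+ (e - size s) \is e.-homog.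
  have := dhomogM (lf_prod_homog s a) (lfX_homog y (e - size s)).
  by rewrite subnKC.
have hp' : p' \is e.-homog by apply: rpredB => //; apply: rpredZ.
have /(ideal2_homogP P0 hp' HP) [x [z E]] : p'.@[fun j => P 0 j] = 0.
  by rewrite mevalB mevalZ mevalM rmorphXn /= lf_eval yP expr1n mulr1 divfK // subrr.
have E' : p' = lf (a l) * pihomog mdeg e.-1 x + lf (a r) * pihomog mdeg e.-1 z.
  by rewrite -(pihomog_dE hp') E pihomogD !(pihomogMl _ _ (lf_homog _)) e0 subn1.
have -> : C * p = lf (a l) * (C * pihomog mdeg e.-1 x) +
    ((c *: lf y ^+ (e - size s)) * (C * Q) + C * lf (a r) * pihomog mdeg e.-1 z).
  have -> : p = p' + c *: (Q * lf y ^+ (e - size s)) by rewrite subrK.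
  by rewrite E' -!mul_mpolyC; ring.
apply: (XD) => //; apply: (XD); first exact: XM.
apply: (IH (C * lf (a r)) e.-1) => //.
- by move=> r' r's; apply: sl; rewrite in_cons r's orbT.
- by move=> r' r'' h' h''; apply: scl; rewrite in_cons ?h' ?h'' orbT.
- move=> r' r's; have := HX r'; rewrite in_cons r's orbT => /(_ isT).
  rewrite big_cons; case: eqVneq => [rr'|_]; first by move: rs; rewrite rr' r's.
  by rewrite mulrA.
- exact: pihomogP.
- by rewrite prednK.
Qed.

Lemma D3_lift w e N : w \is e.-homog -> (N = #|J :\: R| + e)%N -> (#|J| <= N)%N ->
  exists g, [/\ D3 J g, homog_pair N g &
    pdvd (lf (a l)) (act (re l) g - prodl (J :\: R) * w)].
Proof.
move=> hw Ne JN.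
(* The values at l, modulo [lf (a l)], that fields logarithmic along J attain; they form an ideal
   containing [lf (a l)]. *)
pose X x := exists2 g, D3 J g & pdvd (lf (a l)) (act (re l) g - x).
have act0 u : act u (0 : S * S) = 0 by rewrite /act /= !scaler0 addr0.
have iX : ideal X.
  split.
  - by exists 0; [case: (D3_subsp J) | rewrite act0 subrr; apply: pdvd0].
  - move=> x x' [g Dg H] [g' Dg' H']; exists (g + g'); first exact: (subspD (D3_subsp J)).
    by rewrite actD opprD addrACA; apply: pdvdD.
  - move=> f x [g Dg H]; exists (pscal f g); first exact: D3_pscal.
    by rewrite act_pscal -mulrBr; apply: pdvd_mull.
have Xl q : X (lf (a l) * q).
  exists 0; first by case: (D3_subsp J).
  by rewrite act0 sub0r -mulrN; eexists.
(* Any preimage will do, since its component of degree N is again logarithmic and has the same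
   value. *)
suff [g Dg Hg] : X (prodl (J :\: R) * w).
  exists (pipair N g); split; [exact: D3_pipair | exact: pipair_homog |].
  have hBw : prodl (J :\: R) * w \is N.-homog by rewrite Ne; apply: dhomogM => //; apply: prodl_homog.
  by rewrite act_pipair -(pihomog_dE hBw) -pihomogB; apply: pdvd_pihomog (lf_homog _) Hg.
have [R0|Rn] := eqVneq R set0.
  (* Without affine points no factor may be dropped, and a constant field times all lines of J has
     the required value. *)
  rewrite R0 setD0 mulrC; case: (iX) => _ _; apply.
  have [c cl1] := const_field 3 (re_neq0 lh).
  exists (pscal (prodl J) c); last by rewrite act_pscal cl1 mulr1 subrr; apply: pdvd0.
  move=> j jJ; rewrite act_pscal; apply: pdvd_mulr.
  by rewrite /prodl (bigD1 j) //=; eexists.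
apply: (@lagrange_ideal X _ (enum R) e) => //.
- exact: enum_uniq.
- by apply: contraNneq Rn => E; apply/eqP/setP => j; rewrite -mem_enum E !inE.
- by move=> r; rewrite mem_enum => /RJ /Jl.
- move=> r r'; rewrite !mem_enum => rR r'R; apply: contraNN => r'r; apply/eqP/esym.
  by apply: iR => //; apply: cl_eq r'r; apply/Jl/RJ.
- move=> r; rewrite mem_enum => rR.
  have rJ := RJ rR.
  pose d := re l 0 0 * re r 0 1 - re l 0 1 * re r 0 0.
  have d0 : d != 0 by apply: cl_det; [apply: Jl | apply: Rh].
  have -> : prodl (J :\: R) * \prod_(r' <- enum R | r' != r) lf (a r') = prodl (J :\ r).
    rewrite /prodl big_enum_cond [RHS](big_setID R) /= mulrC.
    congr (_ * _); apply: eq_bigl => b; rewrite !inE.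
      by case bR : (b \in R); rewrite ?andbF //= (RJ bR) !andbT.
    by case: eqVneq => [->|] //=; rewrite rR.
  (* The constant field that kills the form of r needs no factor [lf (a r)]. Its value at l is the
     determinant d, nonzero because l and r meet off H. *)
  exists (pscal (d^-1 *: prodl (J :\ r)) ((re r 0 1)%:MP, - (re r 0 0)%:MP)).
    move=> j jJ; rewrite act_pscal; have [->|jr] := eqVneq j r.
      rewrite /act /= scalerN -!mul_mpolyC -!mpolyCM [X in X%:MP - _]mulrC subrr mulr0.
      exact: pdvd0.
    by apply: pdvd_mulr; apply: pdvdZ; rewrite /prodl (bigD1 j) ?inE ?jr //=; eexists.
  rewrite act_pscal (_ : act _ _ = d%:MP).
    by rewrite mulrC mul_mpolyC scalerA mulfV // scale1r subrr; apply: pdvd0.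
  by rewrite /act /= scalerN -!mul_mpolyC -!mpolyCM -mpolyCB.
- rewrite -cardE; have := cardsD J R; rewrite (setIidPr _); last by apply/subsetP => r /RJ.
  have : (#|R| <= #|J|)%N by apply/subset_leq_card/subsetP => r /RJ.
  by lia.
Qed.

End Line.

(** Taking the value at l modulo [lf (a l)] has kernel the fields logarithmic along l as well, and
    image the multiples of a product of fixed degree. So the quotient is the space of forms on l in
    the complementary degree, whose dimension is that degree plus one. *)
Lemma D3_step l (J : {set I}) N : l != h -> l \notin J -> h \notin J -> (#|J| <= N)%N ->
  codim (fun g => D3 J g /\ homog_pair N g) (fun g => D3 (l |: J) g /\ homog_pair N g)
    (N - (#|J| - #|cl l @: [set j in J | h \notin cl l j]|)).+1.
Proof.
move=> lh lJ hJ JN.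
have [R [sR iR cR' cardR]] := exists_reps (cl l) [set j in J | h \notin cl l j].
have cR j : j \in J -> h \notin cl l j -> exists2 r, r \in R & cl l r = cl l j.
  by move=> jJ hj; apply: cR'; rewrite inE jJ.
have RJ : R \subset J by apply/subsetP => r /(subsetP sR); rewrite inE => /andP [].
rewrite -cardR; have cJR : #|J :\: R| = (#|J| - #|R|)%N by rewrite cardsD (setIidPr RJ).
have cRJ := subset_leq_card RJ.
rewrite -cJR; set e := (N - #|J :\: R|)%N.
have Ne : (N = #|J :\: R| + e)%N by rewrite /e cJR; lia.
have lJR : l \notin J :\: R by rewrite !inE (negPf lJ) andbF.
apply: (codim_rel (R := fun w g => pdvd (lf (a l)) (act (re l) g - prodl (J :\: R) * w)))
  (codim_lf3 e (a0 l)).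
- exact: homog_subsp.
- by apply: subspI; [apply: D3_subsp | apply: homog_pair_subsp].
- by rewrite /act /= !scaler0 addr0 mulr0 subrr; apply: pdvd0.
- move=> c w w' g g' H H'; rewrite actD actZ.
  have -> : c *: act (re l) g + act (re l) g' - prodl (J :\: R) * (c *: w + w') =
    c *: (act (re l) g - prodl (J :\: R) * w) + (act (re l) g' - prodl (J :\: R) * w').
    by rewrite mulrDr scalerBr -scalerAr; ring.
  by apply: pdvdD => //; apply: pdvdZ.
- by move=> w hw; have [g [Dg hg H]] := D3_lift lh lJ hJ sR iR hw Ne JN; exists g.
- move=> g [Dg hg]; have [c [w E]] := D3_value lh lJ hJ sR iR cR Dg.
  exists (pihomog mdeg e w); split; first exact: pihomogP.
  have /pihomog_dE <- := act_homog (re l) hg.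
  rewrite {1}E pihomogD (pihomogMl _ _ (prodl_homog _)).
  have -> : (#|J :\: R| <= N)%N by rewrite cJR; lia.
  by rewrite -/e addrK; apply: pdvd_pihomog (lf_homog _) _; eexists.
move=> w g hw [Dg hg] H; split=> [[_ lw]|[/D3_add [_ lg] _]]; split=> //.
  apply/D3_add; split=> //.
  rewrite -[act _ _](subrK (prodl (J :\: R) * w)); apply: pdvdD => //.
  exact: pdvd_mull.
apply: (prodl_dvd_l lJR); have := pdvdB lg H.
by rewrite opprB addrC subrK.
Qed.

End Step.

(** * The characteristic polynomial *)

Section CharPoly.
Variables (K : fieldType) (n : nat) (A : 'M[K]_(n, 3)) (h : 'I_n).
Hypothesis arrA : arrangement A.
Local Notation a := (fun i => row i A).
Local Notation cl := (cl (fun i => row i A)).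
Implicit Types F G : {set 'I_n}.

Let a0 i : row i A != 0. Proof. exact: (proj1 arrA). Qed.
Let an i j : i != j -> ~~ (row i A <= row j A)%MS. Proof. exact: (proj2 arrA). Qed.

Lemma row_rowsF F i : row i (rowsF A F) = if i \in F then row i A else 0.
Proof. by apply/rowP => j; rewrite !mxE; case: ifP => //; rewrite !mxE. Qed.

Lemma rowsF_sub m F (W : 'M[K]_(m, 3)) :
  (forall i, i \in F -> (row i A <= W)%MS) -> (rowsF A F <= W)%MS.
Proof.
move=> H; apply/row_subP => i; rewrite row_rowsF; case: ifP => [/H //|_].
exact: sub0mx.
Qed.

Lemma sub_rowsF F i : i \in F -> (row i A <= rowsF A F)%MS.
Proof. by move=> iF; have := row_sub i (rowsF A F); rewrite row_rowsF iF. Qed.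

Lemma closedP F : reflect (forall i, (row i A <= rowsF A F)%MS -> i \in F) (closedF A F).
Proof. by apply: (iffP forallP) => H i; apply/implyP; apply: H. Qed.

Lemma closedE F i : closedF A F -> (i \in F) = (row i A <= rowsF A F)%MS.
Proof. by move/closedP => H; apply/idP/idP => [/sub_rowsF|/H]. Qed.

Lemma rowsF0 : rowsF A set0 = 0.
Proof. by apply/matrixP => i j; rewrite !mxE inE. Qed.

Lemma closed0 : closedF A set0.
Proof. by apply/closedP => i; rewrite rowsF0 => /submx0null /eqP; rewrite (negPf (a0 i)). Qed.

Lemma rowsF1 i : (rowsF A [set i] :=: row i A)%MS.
Proof.
apply/eqmxP/andP; split; last by apply: sub_rowsF; rewrite set11.
by apply: rowsF_sub => j /set1P ->.
Qed.

Lemma closed1 i : closedF A [set i].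
Proof.
apply/closedP => j; rewrite rowsF1 => ji; rewrite inE.
by apply: contraLR ji => /an.
Qed.

Lemma closedT : closedF A [set: 'I_n].
Proof. by apply/closedP => i; rewrite inE. Qed.

Lemma rank1F i : \rank (rowsF A [set i]) = 1%N.
Proof. by rewrite rowsF1 rank_rV a0. Qed.

Lemma rank_cl i j : i != j -> \rank (row i A + row j A)%MS = 2%N.
Proof. by move=> ij; apply: rank_adds_rV => //; apply: an; rewrite eq_sym. Qed.

Lemma rowsF_cl i j : (rowsF A (cl i j) :=: row i A + row j A)%MS.
Proof.
apply/eqmxP/andP; split; first by apply: rowsF_sub => k; rewrite in_cl.
by rewrite addsmx_sub !sub_rowsF ?in_cl ?addsmxSl ?addsmxSr.
Qed.

Lemma closed_cl i j : closedF A (cl i j).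
Proof. by apply/closedP => k; rewrite rowsF_cl in_cl. Qed.

Lemma rankF_cl i j : i != j -> \rank (rowsF A (cl i j)) = 2%N.
Proof. by move=> ij; rewrite rowsF_cl rank_cl. Qed.

Lemma closed_clE F i j : closedF A F -> \rank (rowsF A F) = 2%N ->
  i != j -> i \in F -> j \in F -> F = cl i j.
Proof.
move=> cF rF ij iF jF.
have s1 : (row i A + row j A <= rowsF A F)%MS by rewrite addsmx_sub !sub_rowsF.
have := mxrank_leqif_eq s1; rewrite rank_cl // rF => -[_]; rewrite eqxx => E.
apply/setP => k; rewrite closedE // in_cl.
by apply/idP/idP => /submx_trans; apply; case/andP: (esym E).
Qed.

Lemma two_elts F : (1 < #|F|)%N -> exists i j, [/\ i != j, i \in F & j \in F].
Proof. by case/card_gt1P => i [j [iF jF ij]]; exists i, j. Qed.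

Lemma small_F F : (#|F| <= 1)%N -> F = set0 \/ exists i, F = [set i].
Proof.
rewrite leq_eqVlt ltnS leqn0 => /orP [/cards1P [i ->]|/eqP/cards0_eq ->].
  by right; exists i.
by left.
Qed.

Lemma big_F_rank F : (1 < #|F|)%N -> (1 < \rank (rowsF A F))%N.
Proof.
case/two_elts => i [j [ij iF jF]].
apply: leq_trans (mxrankS (_ : (row i A + row j A <= rowsF A F)%MS)).
  by rewrite rank_cl.
by rewrite addsmx_sub !sub_rowsF.
Qed.

Lemma mu_fuelE k F : (#|F| <= k)%N -> mu_fuel A k F = mobius A F.
Proof.
rewrite /mobius; have : (#|F| <= #|F|)%N by [].
move: {2 4}#|F| => m; elim: m k F => [|m IH] k F.
  by rewrite leqn0 => /eqP/cards0_eq -> _; case: k => //= k; rewrite eqxx.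
case: k => [|k] Fm Fk.
  by move: Fk; rewrite leqn0 => /eqP/cards0_eq ->; rewrite /= eqxx.
rewrite /=; case: ifP => // _; congr (- _); apply: eq_bigr => G /andP [_ /proper_card GF].
rewrite (IH k) -1?(IH m) //; lia.
Qed.

Lemma mobiusE F : F != set0 ->
  mobius A F = - \sum_(G | closedF A G && (G \proper F)) mobius A G.
Proof.
move=> F0; rewrite -(mu_fuelE (leqnSn _)) /= (negPf F0); congr (- _).
by apply: eq_bigr => G /andP [_ /proper_card /ltnW]; apply: mu_fuelE.
Qed.

Lemma mobius0 : mobius A set0 = 1.
Proof. by rewrite /mobius cards0. Qed.

Lemma mobius1 i : mobius A [set i] = -1.
Proof.
rewrite mobiusE; last by apply/set0Pn; exists i; rewrite set11.
rewrite (big_pred1 set0) ?mobius0 // => G /=; rewrite properE subset1.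
case: (eqVneq G set0) => [->|G0]; last first.
  by rewrite orbF; case: eqVneq => [->|]; rewrite ?subxx ?andbF.
by rewrite closed0 orbT sub1set inE.
Qed.

(** Strictly below a rank-two flat lie only the empty flat and its singletons, with values 1 and
    -1. *)
Lemma mobius2 F : closedF A F -> \rank (rowsF A F) = 2%N ->
  mobius A F = #|F|%:Z - 1.
Proof.
move=> cF rF; have F1 : (1 < #|F|)%N.
  rewrite ltnNge; apply/negP => /small_F [F0|[i Fi]]; move: rF.
    by rewrite F0 rowsF0 mxrank0.
  by rewrite Fi rank1F.
rewrite mobiusE; last by rewrite -card_gt0; lia.
rewrite (bigD1 set0) /=; last first.
  by rewrite closed0 properEcard sub0set cards0; lia.
rewrite mobius0 (eq_bigl (mem [set [set i] | i in F])) => [|G /=]; last first.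
  apply/idP/imsetP => [/andP [/andP [cG GF] G0]|[i iF ->]]; last first.
    rewrite closed1 properEcard sub1set iF cards1 F1 /=.
    by apply/set0Pn; exists i; rewrite set11.
  have sGF := proper_sub GF.
  have /small_F [G0'|[i Gi]] : (#|G| <= 1)%N.
  - rewrite leqNgt; apply/negP => /two_elts [i [j [ij iG jG]]].
    have FE := closed_clE cF rF ij (subsetP sGF _ iG) (subsetP sGF _ jG).
    move: GF; rewrite properE => /andP [_ /negP []].
    apply/subsetP => k; rewrite FE in_cl (closedE _ cG) => /submx_trans; apply.
    by rewrite addsmx_sub !sub_rowsF.
  - by rewrite G0' eqxx in G0.
  by exists i => //; apply: (subsetP sGF); rewrite Gi set11.
rewrite big_imset /=; last by move=> i j _ _ /set1_inj.
rewrite (eq_bigr (fun=> -1)) => [|i _]; last exact: mobius1.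
by rewrite sumr_const mulNrn opprD opprK natz addrC.
Qed.

(** The sum of the Moebius values over the rank-two flats, which is the linear coefficient of the
    characteristic polynomial. *)
Definition b2 : int :=
  \sum_(F | closedF A F && (\rank (rowsF A F) == 2%N)) (#|F|%:Z - 1).

Lemma charpolyE : charpoly A =
  'X^3 - n%:R *: 'X^2 + b2 *: 'X + (n%:R - 1 - b2)%:P.
Proof.
have n0 : (0 < n)%N by case: n h => // -[].
pose m r : int := \sum_(F | closedF A F && (\rank (rowsF A F) == r)) mobius A F.
have rk F : (\rank (rowsF A F) < 4)%N by rewrite ltnS rank_leq_col.
have E (g : nat -> {poly int}) :
    \sum_(F | closedF A F) mobius A F *: g (\rank (rowsF A F)) =
    \sum_(r < 4) m r *: g r.
  rewrite (partition_big (fun F => Ordinal (rk F)) predT) //=; apply: eq_bigr => r _.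
  rewrite /m scaler_suml; apply: eq_big => F; first by rewrite -val_eqE.
  by case/andP => _ /eqP <-.
have m0 : m 0%N = 1.
  rewrite /m (big_pred1 set0) ?mobius0 // => F /=.
  apply/andP/eqP => [[cF /eqP]|->]; last by rewrite closed0 rowsF0 mxrank0.
  move/eqP; rewrite mxrank_eq0 => /eqP F0.
  apply/setP => i; rewrite inE; apply/negP => /sub_rowsF; rewrite F0.
  by move/submx0null/eqP; rewrite (negPf (a0 i)).
have m1 : m 1%N = - n%:R.
  rewrite /m (eq_bigl (mem [set [set i] | i in [set: 'I_n]])) => [|F /=]; last first.
    apply/andP/imsetP => [[cF /eqP rF]|[i _ ->]]; last by rewrite closed1 rank1F.
    have /small_F [F0|[i Fi]] : (#|F| <= 1)%N.
    - by rewrite leqNgt; apply/negP => /big_F_rank; rewrite rF.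
    - by move: rF; rewrite F0 rowsF0 mxrank0.
    by exists i; rewrite ?inE.
  rewrite big_imset /=; last by move=> i j _ _ /set1_inj.
  rewrite (eq_bigr (fun=> -1)) => [|i _]; last exact: mobius1.
  by rewrite sumr_const cardsT card_ord mulNrn.
have m2 : m 2%N = b2.
  by apply: eq_bigr => F /andP [cF /eqP rF]; apply: mobius2.
(* The full set is the top flat, so all Moebius values sum to zero. This determines the constant
   coefficient whether or not the arrangement has rank three. *)
have m3 : m 3%N = n%:R - 1 - b2.
  have : \sum_(F | closedF A F) mobius A F = 0.
    have T0 : [set: 'I_n] != set0 by apply/set0Pn; exists (Ordinal n0); rewrite inE.
    rewrite (bigD1 [set: 'I_n]) ?closedT //= (mobiusE T0).
    apply/eqP; rewrite addrC subr_eq0; apply/eqP; apply: eq_bigl => G.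
    by rewrite properEneq subsetT andbT.
  move=> H0; have := E (fun=> 1); rewrite -scaler_suml H0 scale0r.
  rewrite !big_ord_recr big_ord0 /= m0 m1 m2 add0r => /esym/eqP.
  rewrite -!scalerDl alg_polyC polyC_eq0 => /eqP H.
  by rewrite -[LHS]subr0 -H; ring.
rewrite /charpoly (E (fun r => 'X^(3 - r))) !big_ord_recr big_ord0 /=.
rewrite m0 m1 m2 m3 add0r scale1r scaleNr expr1 expr0 alg_polyC.
by [].
Qed.

Lemma charpoly0E : (charpoly0 A).[0] = b2 - (n%:R - 1).
Proof.
rewrite /charpoly0 charpolyE -polyC1.
have -> : 'X^3 - n%:R *: 'X^2 + b2 *: 'X + (n%:R - 1 - b2)%:P =
    ('X^2 + (1 - n%:R) *: 'X + (b2 - (n%:R - 1))%:P) * ('X - 1%:P).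
  by rewrite -!mul_polyC !polyCB !polyC1; ring.
rewrite (Pdiv.IdomainMonic.mulpK (monicXsubC 1)).
by rewrite !hornerE ?expr0n ?expr2 /= ?mulr0 ?add0r.
Qed.

(** Rank-two flats are the points, each weighted by one less than its number of lines. Those on H
    have total weight n - 1. For a point off H, the weight counts its lines other than the one of
    least index, that is, the lines l for which the point already lies on an earlier line. *)
Lemma b2E : b2 - (n%:R - 1) =
  (\sum_l #|cl l @: [set j : 'I_n | [&& (j < l)%N, j != h & h \notin cl l j]]|)%N%:R.
Proof.
pose E2 := [pred F | closedF A F && (\rank (rowsF A F) == 2%N)].
have E2gt F : E2 F -> (0 < #|F|)%N.
  case/andP => _ rF; rewrite card_gt0; apply: contraTneq rF => ->.
  by rewrite rowsF0 mxrank0.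
have E2cl F i j : E2 F -> i != j -> i \in F -> j \in F -> F = cl i j.
  by case/andP => cF /eqP rF; apply: closed_clE.
have clE2 i j : i != j -> E2 (cl i j).
  by move=> ij; rewrite /= closed_cl rankF_cl.
have b2N : b2 = (\sum_(F | E2 F) #|F|.-1)%:R.
  rewrite natr_sum; apply: eq_bigr => F /E2gt.
  by case: #|F| => // k _; rewrite /= natz -addn1 PoszD addrK.
(* Each line j other than h meets h in exactly one point, the flat [cl h j]. *)
have hN : (\sum_(F | E2 F && (h \in F)) #|F|.-1 = n.-1)%N.
  transitivity (\sum_(F | E2 F && (h \in F)) \sum_(j | (j != h) && (j \in F)) 1)%N.
    apply: eq_bigr => F /andP [_ hF]; rewrite sum1_card (cardsD1 h) hF /=.
    by apply: eq_card => j; rewrite !inE.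
  rewrite (exchange_big_dep (fun j => j != h)) /=; last by move=> F j _ /andP [].
  rewrite (eq_bigr (fun=> 1%N)) => [|j jh]; last first.
    rewrite (big_pred1 (cl h j)) // => F /=; rewrite jh /=.
    apply/andP/eqP => [[/andP [eF hF] jF]|->]; first by apply: E2cl => //; rewrite eq_sym.
    have hj : h != j by rewrite eq_sym.
    by have /andP [c1 c2] := clE2 _ _ hj; rewrite !in_cl addsmxSl addsmxSr c1 c2.
  by have := cardC1 h; rewrite card_ord sum1_card => <-; apply: eq_card.
have nhN : (\sum_(F | E2 F && (h \notin F)) #|F|.-1 =
    \sum_l #|cl l @: [set j : 'I_n | [&& (j < l)%N, j != h & h \notin cl l j]]|)%N.
  pose nm F l := [exists j, (j \in F) && (j < l)%N].
  (* The lines of F that have a smaller index below them in F are all but the least. *)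
  transitivity (\sum_(F | E2 F && (h \notin F)) \sum_(l | (l \in F) && nm F l) 1)%N.
    apply: eq_bigr => F /andP [eF _].
    have /card_gt0P [i0 i0F] := E2gt _ eF.
    have [m mF mmin] : exists2 m, m \in F & forall j, j \in F -> (m <= j)%N.
      by case: (arg_minnP (fun i : 'I_n => i : nat) i0F) => m mF mmin; exists m.
    rewrite sum1_card (cardsD1 m) mF /=; apply: eq_card => l; rewrite in_setD1 [RHS]unfold_in /=.
    case lF : (l \in F); rewrite ?andbF ?andbT //=.
    apply/idP/existsP => [lm|[j /andP [jF jl]]].
      by exists m; rewrite mF ltn_neqAle eq_sym lm mmin.
    by apply: contraTneq jl => ->; rewrite -leqNgt mmin.
  rewrite (exchange_big_dep predT) //=; apply: eq_bigr => l _.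
  rewrite sum1_card; apply: eq_card => F; rewrite unfold_in; apply/idP/imsetP.
    case/andP => /andP [eF hF] /andP [lF /existsP [j /andP [jF jl]]].
    have FE : F = cl l j by apply: E2cl => //; rewrite -val_eqE /= neq_ltn jl orbT.
    exists j => //; rewrite inE jl -FE hF andbT.
    by apply: contraNneq hF => <-.
  case=> j; rewrite inE => /and3P [jl jh hj] ->.
  have lj : l != j by rewrite -val_eqE /= neq_ltn jl orbT.
  have /andP [c1 c2] := clE2 _ _ lj.
  rewrite c1 c2 hj in_cl addsmxSl; apply/existsP; exists j.
  by rewrite jl in_cl addsmxSr.
rewrite b2N (bigID (fun F => h \in F)) /= hN nhN natrD.
have n0 : (0 < n)%N by case: n h => // -[].
have -> : n%:R - 1 = n.-1%:R :> int by rewrite -[n in LHS](prednK n0) -addn1 natrD addrK.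
by rewrite addrC addKr.
Qed.

End CharPoly.

(** * Restriction to [H] *)

Section Restriction.
Variable K : fieldType.
Local Notation S3 := {mpoly K[3]}.
Local Notation S2 := {mpoly K[2]}.

Lemma comp_mpoly_comp n m k (x : n.-tuple {mpoly K[m]}) (y : m.-tuple {mpoly K[k]}) p :
  (p \mPo x) \mPo y = p \mPo [tuple tnth x i \mPo y | i < n].
Proof.
rewrite [p \mPo x]comp_mpolyE [RHS]comp_mpolyE raddf_sum; apply: eq_bigr => mm _ /=.
rewrite comp_mpolyZ rmorph_prod; congr (_ *: _); apply: eq_bigr => i _ /=.
by rewrite rmorphXn tnth_mktuple.
Qed.

Lemma comp_mpoly_homog n m (x : n.-tuple {mpoly K[m]}) d p :
  (forall i, tnth x i \is 1.-homog) -> p \is d.-homog -> p \mPo x \is d.-homog.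
Proof.
move=> hx /dhomogP hp; rewrite comp_mpolyE big_seq; apply: rpred_sum => mm /hp /= <-.
apply: rpredZ; rewrite mdegE; elim/big_rec2: _ => [|i q e _ he]; first exact: dhomog1.
by apply: dhomogM => //; have := dhomogMn (mm i) (hx i); rewrite mul1n.
Qed.

Lemma comp_mpoly_pihomog n m (x : n.-tuple {mpoly K[m]}) d p :
  (forall i, tnth x i \is 1.-homog) ->
  pihomog mdeg d (p \mPo x) = pihomog mdeg d p \mPo x.
Proof.
move=> hx; rewrite {1}(pihomog_partitionE (leqnn (mmeasure mdeg p))).
set s := mmeasure _ _; rewrite (raddf_sum (comp_mpoly x)) (raddf_sum (pihomog mdeg d)) /=.
have E (i : 'I_s) : pihomog mdeg d (pihomog mdeg i p \mPo x) =
    if i == d :> nat then pihomog mdeg d p \mPo x else 0.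
  have hi : pihomog mdeg i p \mPo x \is i.-homog.
    by apply: comp_mpoly_homog => //; apply: pihomogP.
  case: eqP => [<-|/eqP ne]; first by rewrite pihomog_dE.
  by rewrite (pihomog_ne0 ne).
under eq_bigr => i _ do rewrite E.
case: (ltnP d s) => [lt|ge].
  rewrite (bigD1 (Ordinal lt)) //= eqxx big1 ?addr0 // => i /eqP ne.
  by case: eqP => // e; case: ne; apply: val_inj.
rewrite big1 => [|i _]; last by case: eqP => // e; move: ge; rewrite -e leqNgt ltn_ord.
rewrite (_ : pihomog mdeg d p = 0) ?comp_mpoly0 //.
rewrite /pihomog big_seq_cond big1 // => m' /andP [ms /eqP e].
by have := mmeasure_mnm_lt mdeg ms; rewrite /= e -/s ltnNge ge.
Qed.

Local Notation rho := (@rho K).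

(** Polynomials in z2, z3 regarded as polynomials in z1, z2, z3: a section of the restriction
    [rho]. *)
Definition emb (q : S2) : S3 :=
  q \mPo [tuple 'X_(lift ord0 ord0); 'X_(lift ord0 (lift ord0 ord0))].

Lemma tnth_ord2 T (x y : T) (i : 'I_2) :
  tnth [tuple x; y] i = if i == ord0 then x else y.
Proof. by case: i => [[|[|]]]. Qed.

Lemma tnth_ord3 T (x y z : T) (i : 'I_3) :
  tnth [tuple x; y; z] i = if i == ord0 then x else
    if i == lift ord0 ord0 then y else z.
Proof. by case: i => [[|[|[|]]]]. Qed.

Lemma rho_homog d p : p \is d.-homog -> rho p \is d.-homog.
Proof.
apply: comp_mpoly_homog => i; rewrite tnth_ord3.
by case: ifP => _; [apply: dhomog0 | case: ifP => _; rewrite dhomogX /= mdeg1].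
Qed.

Lemma rho_pihomog d p : pihomog mdeg d (rho p) = rho (pihomog mdeg d p).
Proof.
apply: comp_mpoly_pihomog => i; rewrite tnth_ord3.
by case: ifP => _; [apply: dhomog0 | case: ifP => _; rewrite dhomogX /= mdeg1].
Qed.

Lemma emb_homog d q : q \is d.-homog -> emb q \is d.-homog.
Proof.
apply: comp_mpoly_homog => i; rewrite tnth_ord2.
by case: ifP => _; rewrite dhomogX /= mdeg1.
Qed.

Lemma embK q : rho (emb q) = q.
Proof.
rewrite /rho /emb comp_mpoly_comp -[RHS]comp_mpoly_id; congr (_ \mPo _).
apply: eq_from_tnth => i; rewrite !tnth_mktuple tnth_ord2.
case: (eqVneq i ord0) => [->|ni]; rewrite comp_mpolyXU //=.
by congr 'X_ _; case: i ni => [[|[|]]] // *; apply: val_inj.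
Qed.

Lemma rhoK p : pdvd 'X_ord0 (p - emb (rho p)).
Proof.
rewrite /rho /emb comp_mpoly_comp -{1}[p]comp_mpoly_id.
apply: ideal_comp_congr; first exact: pdvd_ideal.
move=> i; rewrite !tnth_mktuple tnth_ord3.
case: (eqVneq i ord0) => [->|n0]; first by rewrite comp_mpoly0 subr0; apply: pdvd_refl.
case: (eqVneq i (lift ord0 ord0)) => [->|n1]; rewrite comp_mpolyXU /= ?subrr; first exact: pdvd0.
rewrite (_ : i = lift ord0 (lift ord0 ord0)) ?subrr; first exact: pdvd0.
by case: i n0 n1 => [[|[|[|]]]] // *; apply: val_inj.
Qed.

Lemma rho_eq0 p : rho p = 0 -> pdvd 'X_ord0 p.
Proof. by move=> E; have := rhoK p; rewrite E /emb comp_mpoly0 subr0. Qed.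

Lemma rhoM p q : rho (p * q) = rho p * rho q. Proof. exact: rmorphM. Qed.
Lemma rhoD p q : rho (p + q) = rho p + rho q. Proof. exact: raddfD. Qed.
Lemma rhoB p q : rho (p - q) = rho p - rho q. Proof. exact: raddfB. Qed.
Lemma rhoZ c p : rho (c *: p) = c *: rho p. Proof. exact: linearZ. Qed.

Lemma rhoX0 : rho 'X_ord0 = 0.
Proof. by rewrite /rho comp_mpolyXU. Qed.

Lemma rho_lf u : rho (lf u) = lf (resvec u).
Proof.
rewrite /rho lf_comp /lf !big_ord_recl !big_ord0 !tnth_ord3 /= !mxE scaler0 add0r.
by congr (_ + (_ *: 'X_ _ + _)); apply: val_inj.
Qed.

Definition rho2 (g : S3 * S3) : S2 * S2 := (rho g.1, rho g.2).

Lemma rho2P c g g' : rho2 (c *: g + g') = c *: rho2 g + rho2 g'.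
Proof. by congr pair; rewrite /= rhoD rhoZ. Qed.

Lemma rho2B g g' : rho2 (g - g') = rho2 g - rho2 g'.
Proof. by congr pair; rewrite /= rhoB. Qed.

Lemma rho2_homog d g : homog_pair d g -> homog_pair d (rho2 g).
Proof. by case=> h1 h2; split; apply: rho_homog. Qed.

Lemma act_rho2 u g : act u (rho2 g) = rho (act u g).
Proof. by rewrite /act rhoD !rhoZ. Qed.

Lemma rho2_eq0 g : rho2 g = 0 -> exists g', g = pscal 'X_ord0 g'.
Proof.
move=> E; have /rho_eq0 [x Ex] : rho g.1 = 0 by have := congr1 fst E.
have /rho_eq0 [y Ey] : rho g.2 = 0 by have := congr1 snd E.
by exists (x, y); case: g Ex Ey {E} => g1 g2 /= -> ->.
Qed.

End Restriction.

(** * Codimension of D_H in each degree and of its restriction to H *)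

Section Main.
Variables (K : fieldType) (n : nat) (A : 'M[K]_(n, 3)) (h : 'I_n).
Hypothesis arrA : arrangement A.
Hypothesis rowh : row h A = delta_mx 0 0.
Local Notation S3 := {mpoly K[3]}.
Local Notation S2 := {mpoly K[2]}.
Local Notation rho := (@rho K).
Local Notation a := (fun i : 'I_n => row i A).
Local Notation v := (fun i : 'I_n => resvec (row i A)).
Let J := [set~ h].
Local Notation D := (D3 a J).
Local Notation DD := (D2 v J).

Let a0 i : row i A != 0. Proof. exact: (proj1 arrA). Qed.
Let an i j : i != j -> ~~ (row i A <= row j A)%MS. Proof. exact: (proj2 arrA). Qed.
Let v0 i : i \in J -> resvec (row i A) != 0.
Proof. by rewrite !inE; apply: (@re_neq0 _ _ a h rowh an). Qed.

Definition M1 (g : S2 * S2) : Prop := exists2 G, D G & g = rho2 G.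

Lemma D_subsp : subsp D. Proof. exact: D3_subsp. Qed.
Lemma DD_subsp : subsp DD. Proof. exact/submod_subsp/D2_submod. Qed.

Lemma M1_subsp : subsp M1.
Proof.
split=> [|c u w [G DG ->] [G' DG' ->]].
  by exists 0; [case: D_subsp | congr pair; rewrite /= /rho comp_mpoly0].
by exists (c *: G + G'); [apply: (proj2 D_subsp) | rewrite rho2P].
Qed.

(** All lines with the same restriction to H as i divide the same value, up to scalars. They are
    pairwise coprime before restriction, so their product divides it, and this product restricts to
    a power of one form, the multiplicity being the exponent. *)
Lemma M1_DD g : M1 g -> DD g.
Proof.
move=> [G DG ->] i iJ; rewrite act_rho2.
pose T := [set j in J | par v i j].
have TJ j : j \in T -> j \in J by rewrite inE => /andP [].
have : pdvd (\prod_(j <- enum T) lf (row j A)) (act (resvec (row i A)) G).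
  apply: (@lf_prod_dvd _ _ _ (enum T) a) => [|j _|j k _ _|j].
  - exact: enum_uniq.
  - exact: a0.
  - exact: an.
  rewrite mem_enum => jT; have jJ := TJ _ jT.
  have ij : par v i j by move: jT; rewrite inE => /andP [].
  have [c c0 vj] := par_scale (v0 iJ) (v0 jJ) ij.
  have := DG j jJ; rewrite vj act_scale => /(pdvdZ c^-1).
  by rewrite scalerA mulVf // scale1r.
case=> w ->; rewrite rhoM.
have [c c0 ->] : exists2 c : K, c != 0 &
    rho (\prod_(j <- enum T) lf (row j A)) = c *: lf (resvec (row i A)) ^+ multJ v J i.
  rewrite /multJ -/T cardE.
  have : {subset enum T <= T} by move=> j; rewrite mem_enum.
  elim: (enum T) => [|j s IH] sub.
    by exists 1; rewrite ?oner_eq0 // big_nil scale1r /rho rmorph1.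
  have [k ks|c c0 E] := IH; first by apply: sub; rewrite in_cons ks orbT.
  have jT : j \in T by apply: sub; rewrite mem_head.
  have ij : par v i j by move: jT; rewrite inE => /andP [].
  have [d d0 vj] := par_scale (v0 iJ) (v0 (TJ _ jT)) ij.
  exists (d * c); first by rewrite mulf_neq0.
  by rewrite big_cons rhoM E rho_lf vj linearZ /= exprS -scalerAl -scalerAr scalerA.
by rewrite -scalerAl scalerAr; eexists.
Qed.

Lemma DD_pipair d g : DD g -> DD (pipair d g).
Proof.
by move=> H j jJ; rewrite act_pipair; apply: pdvd_pihomog (lfX_homog _ _) _; apply: H.
Qed.

Lemma M1_pipair d g : M1 g -> M1 (pipair d g).
Proof.
case=> G DG ->; exists (pipair d G); first exact: D3_pipair.
by congr pair; apply: rho_pihomog.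
Qed.

Lemma lf_ndvd_X0 j : j \in J -> ~ pdvd (lf (row j A)) 'X_ord0.
Proof.
rewrite !inE => jh; rewrite -lf_delta -rowh => /(lf_dvd_lf (a0 j)).
by rewrite (negPf (an _)) // eq_sym.
Qed.

Lemma D_X0 g : D (pscal 'X_ord0 g) <-> D g.
Proof.
split=> H; last exact: D3_pscal.
move=> j jJ; have := H j jJ; rewrite act_pscal => /(lf_prime (a0 j)) [|//].
by move/(lf_ndvd_X0 jJ).
Qed.

(** The lines are added in index order, those after x others costing N + 1 - x plus their affine
    points. The formula is doubled and arranged without subtraction; n <= N keeps every truncated
    difference exact. *)
Lemma D_dim N : (n <= N)%N -> exists2 c,
  codim (@homog_pair K 3 N) (fun g => D g /\ homog_pair N g) c &
  (2 * c + n.-1 ^ 2 = 2 * n.-1 * N.+1 + n.-1 +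
   2 * \sum_l #|cl a l @: [set j : 'I_n | [&& (j < l)%N, j != h & h \notin cl a l j]]|)%N.
Proof.
move=> nN; pose s (l : 'I_n) := #|cl a l @: [set j : 'I_n | [&& (j < l)%N, j != h & h \notin cl a l j]]|.
pose Jk k := [set j : 'I_n | (j < k)%N && (j != h)].
have H k : (k <= n)%N -> exists2 c,
    codim (@homog_pair K 3 N) (fun g => D3 a (Jk k) g /\ homog_pair N g) c &
    (2 * c + #|Jk k| ^ 2 = 2 * #|Jk k| * N.+1 + #|Jk k| + 2 * \sum_(l : 'I_n | (l < k)%N) s l)%N.
  elim: k => [|k IH] kn.
    have J0 : Jk 0%N = set0 by apply/setP => j; rewrite !inE.
    exists 0%N; last by rewrite J0 cards0 big_pred0.
    by apply: codim_self => g hg; split=> // j; rewrite J0 inE.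
  have [c cc E] := IH (ltnW kn); pose l := Ordinal kn.
  have sumE : (\sum_(i : 'I_n | (i < k.+1)%N) s i = s l + \sum_(i : 'I_n | (i < k)%N) s i)%N.
    rewrite (bigD1 l) //=; congr (_ + _)%N; apply: eq_bigl => i.
    by rewrite ltnS -val_eqE /= ltn_neqAle andbC.
  (* The line h itself is passed over: h belongs to every [cl a h j], so its term in the sum is
     zero. *)
  have [lh|lh] := eqVneq l h.
    have JE : Jk k.+1 = Jk k.
      apply/setP => j; rewrite !inE ltnS leq_eqVlt andb_orl.
      case: eqVneq => //= e; rewrite (_ : j = h) ?eqxx ?andbF //.
      by rewrite -lh; apply: val_inj.
    have sl : s l = 0%N.
      apply/eqP; rewrite cards_eq0 -subset0; apply/subsetP => F /imsetP [j].
      by rewrite inE -lh in_cl addsmxSl !andbF.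
    by exists c; rewrite JE // sumE sl add0n.
  have lJ : l \notin Jk k by rewrite inE ltnn.
  have hJ : h \notin Jk k by rewrite inE eqxx andbF.
  have JE : Jk k.+1 = l |: Jk k.
    apply/setP => j; rewrite !inE ltnS leq_eqVlt andb_orl -(val_eqE j l) /=.
    by case: eqVneq => //= e; rewrite (_ : j = l) ?lh //; apply: val_inj.
  have cJN : (#|Jk k| <= N)%N by apply: leq_trans (max_card _) _; rewrite card_ord.
  have := D3_step rowh a0 an lh lJ hJ cJN; rewrite -JE.
  have -> : [set j in Jk k | h \notin cl a l j] =
      [set j : 'I_n | [&& (j < l)%N, j != h & h \notin cl a l j]].
    by apply/setP => j; rewrite !inE andbA.
  rewrite -/(s l) => st.
  have sJ : (s l <= #|Jk k|)%N.
    apply: leq_trans (leq_imset_card _ _) _; apply: subset_leq_card; apply/subsetP => j.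
    by rewrite !inE => /and3P [-> ->].
  exists (c + (N - (#|Jk k| - s l)).+1)%N.
    apply: codim_trans cc st.
    - exact: homog_pair_subsp.
    - by apply: subspI; [apply: D3_subsp | apply: homog_pair_subsp].
    - by apply: subspI; [apply: D3_subsp | apply: homog_pair_subsp].
    - by move=> g [].
    - by move=> g [Dg hg]; split=> // j jJ; apply: Dg; rewrite JE setU1r.
  rewrite sumE JE cardsU1 lJ add1n; move: E sJ cJN; move: (#|Jk k|) (s l) (\sum_(i | _) _)%N => x y z E yx xN.
  rewrite -!mulnn in E *; nia.
have [c cc E] := H n (leqnn n).
have Jn : Jk n = J by apply/setP => j; rewrite !inE ltn_ord.
have cJ : #|J| = n.-1 by rewrite cardsC1 card_ord.
exists c; first by rewrite -Jn.
by move: E; rewrite Jn cJ => ->; congr (_ + 2 * _)%N; apply: eq_bigl => l; rewrite ltn_ord.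
Qed.

Lemma D_homog_subsp N : subsp (fun g => D g /\ homog_pair N g).
Proof. by apply: subspI; [apply: D_subsp | apply: homog_pair_subsp]. Qed.

Lemma DD_homog_subsp N : subsp (fun g => DD g /\ homog_pair N g).
Proof. by apply: subspI; [apply: DD_subsp | apply: homog_pair_subsp]. Qed.

Lemma M1_homog_subsp N : subsp (fun g => M1 g /\ homog_pair N g).
Proof. by apply: subspI; [apply: M1_subsp | apply: homog_pair_subsp]. Qed.

Lemma M1_homog_lift N g : M1 g -> homog_pair N g ->
  exists G, [/\ D G, homog_pair N G & g = rho2 G].
Proof.
move=> [G DG gE] [h1 h2]; exists (pipair N G); split.
- exact: D3_pipair.
- exact: pipair_homog.
rewrite gE /= in h1 h2; rewrite gE; congr pair; rewrite /= -rho_pihomog pihomog_dE //.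
Qed.

Lemma emb2_homog N (g : S2 * S2) : homog_pair N g ->
  homog_pair N (emb g.1, emb g.2) /\ rho2 (emb g.1, emb g.2) = g.
Proof.
move=> [h1 h2]; split; first by split; apply: emb_homog.
by case: g {h1 h2} => g1 g2; rewrite /rho2 /= !embK.
Qed.

Lemma X0_homog_quot N g (G : S3 * S3) : homog_pair N.+1 G -> G = pscal 'X_ord0 g ->
  G = pscal 'X_ord0 (pipair N g).
Proof.
move=> [h1 h2] E; have hX : ('X_ord0 : S3) \is 1.-homog by rewrite dhomogX /= mdeg1.
rewrite E /= in h1 h2; rewrite E; congr pair => /=.
  by apply: (homog_quot hX); rewrite add1n.
by apply: (homog_quot hX); rewrite add1n.
Qed.

(** The intermediate space W consists of the fields whose restriction lies in M^1. Restriction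
    identifies the quotient by W with that of the plane fields by M^1. A field in W differs from an
    element of D_H by a multiple of z1, so W modulo D_H is the same quotient one degree lower. *)
Lemma D_dim_step N c :
  codim (@homog_pair K 3 N.+1) (fun g => D g /\ homog_pair N.+1 g) c ->
  exists b e, [/\ codim (@homog_pair K 3 N) (fun g => D g /\ homog_pair N g) b,
    codim (@homog_pair K 2 N.+1) (fun g => M1 g /\ homog_pair N.+1 g) e & c = (e + b)%N].
Proof.
pose W (G : S3 * S3) := M1 (rho2 G) /\ homog_pair N.+1 G.
have rho0 : rho2 (0 : S3 * S3) = 0 by congr pair; rewrite /= /rho comp_mpoly0.
have sW : subsp W.
  apply: subspI; last exact: homog_pair_subsp.
  split=> [|k u w Mu Mw]; first by rewrite rho0; case: M1_subsp.
  by rewrite rho2P; apply: (proj2 M1_subsp).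
move=> /(codim_mid (homog_pair_subsp _ _ _) sW (D_homog_subsp _)) [||e [b [ce cb ->]]].
- by move=> G [].
- by move=> G [DG hG]; split=> //; exists G.
exists b, e; split=> //.
  apply: (codim_rel (R := fun G G' => D (G - pscal 'X_ord0 G'))) cb => //.
  - exact: homog_pair_subsp.
  - rewrite (_ : pscal _ _ = 0) ?subr0; first by case: D_subsp.
    by congr pair; rewrite /= mulr0.
  - move=> k G H G' H' DG DH.
    rewrite (_ : _ - _ = k *: (G - pscal 'X_ord0 G') + (H - pscal 'X_ord0 H')).
      exact: (proj2 D_subsp).
    by congr pair; rewrite /= mulrDr scalerBr -scalerAr; ring.
  - move=> G [MG hG]; have [G0 [DG0 hG0 E]] := M1_homog_lift MG (rho2_homog hG).
    have [|g' gE] := @rho2_eq0 _ (G - G0); first by rewrite rho2B E subrr.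
    have hGG : homog_pair N.+1 (G - G0) by apply: (subspB (homog_pair_subsp _ _ _)).
    exists (pipair N g'); split; first exact: pipair_homog.
    by rewrite -(X0_homog_quot hGG gE) subKr.
  - move=> G' hG'; exists (pscal 'X_ord0 G'); rewrite subrr; split; last by case: D_subsp.
    split; last by rewrite -(add1n N); apply: homog_pair_scal => //; rewrite dhomogX /= mdeg1.
    rewrite (_ : rho2 _ = 0); first by case: M1_subsp.
    by congr pair; rewrite /= rhoM rhoX0 mul0r.
  - move=> G G' [_ hG] hG' DGG; have := subspBK D_subsp DGG.
    by rewrite D_X0; tauto.
apply: (codim_rel (R := fun G g => g = rho2 G)) ce => //.
- exact: homog_pair_subsp.
- exact: homog_pair_subsp.
- by move=> k G H _ _ -> ->; rewrite rho2P.
- by move=> G hG; exists (rho2 G); split=> //; apply: rho2_homog.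
- by move=> g hg; have [h1 h2] := emb2_homog hg; eexists; split; [exact: h1 |].
- by move=> G g hG hg ->; rewrite /W; have := rho2_homog hG; tauto.
Qed.

(** In degree 0 there is no nonzero multiple of z1, so restriction loses nothing. *)
Lemma D_dim0 c :
  codim (@homog_pair K 3 0) (fun g => D g /\ homog_pair 0 g) c ->
  codim (@homog_pair K 2 0) (fun g => M1 g /\ homog_pair 0 g) c.
Proof.
apply: (codim_rel (R := fun G g => g = rho2 G)) => //.
- exact: homog_pair_subsp.
- exact: homog_pair_subsp.
- by congr pair; rewrite /= /rho comp_mpoly0.
- by move=> k G H _ _ -> ->; rewrite rho2P.
- by move=> G hG; exists (rho2 G); split=> //; apply: rho2_homog.
- by move=> g hg; have [h1 h2] := emb2_homog hg; eexists; split; [exact: h1 |].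
move=> G g hG hg gE; split=> [[DG _]|[Mg _]]; split=> //; first by exists G.
have [G0 [DG0 hG0 E]] := M1_homog_lift Mg hg.
have [|g' g'E] := @rho2_eq0 _ (G - G0); first by rewrite rho2B -E -gE subrr.
have [h1 h2] : homog_pair 0 (G - G0) by apply: (subspB (homog_pair_subsp _ _ _)).
suff -> : G = G0 by [].
apply/eqP; rewrite -subr_eq0; apply/eqP.
have hX : ('X_ord0 : S3) \is 1.-homog by rewrite dhomogX /= mdeg1.
rewrite g'E /= in h1 h2; rewrite g'E; congr pair.
  exact: homog_small hX h1 _.
exact: homog_small hX h2 _.
Qed.

Section Basis.
Variables (th1 th2 : S2 * S2) (d2 d3 : nat).
Hypothesis Bth : gbasis DD th1 th2.
Hypothesis hth1 : homog_pair d2 th1.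
Hypothesis hth2 : homog_pair d3 th2.

(** The codimension in one degree N determines the sum of the exponents, so it agrees with that of
    the basis built line by line. N is taken above all four degrees so that no difference is
    truncated. *)
Lemma degree_sum : (d2 + d3 = n.-1)%N.
Proof.
have [e1 [e2 [et1 [et2 [B' h1 h2 E]]]]] := D2_basis v0.
pose N := (d2 + d3 + e1 + e2)%N.
have [q cq Eq] := gbasis_codim N (D2_submod v J) Bth hth1 hth2.
have [q' cq' Eq'] := gbasis_codim N (D2_submod v J) B' h1 h2.
have qq : q = q'.
  by apply: codim_uniq (homog_pair_subsp _ _ _) (DD_homog_subsp N) _ cq cq' => g [].
by move: E; rewrite cardsC1 card_ord => <-; rewrite /N in Eq Eq'; lia.
Qed.

(** The codimension of D(A^H, k) in degree j: 2 (j + 1) minus the dimensions of the two coefficient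
    spaces. *)
Definition plane_codim j := (minn j.+1 d2 + minn j.+1 d3)%N.

Lemma M1_dim_split j e :
  codim (@homog_pair K 2 j) (fun g => M1 g /\ homog_pair j g) e ->
  exists2 c, codim (fun g => DD g /\ homog_pair j g) (fun g => M1 g /\ homog_pair j g) c &
    e = (plane_codim j + c)%N.
Proof.
move=> ce; have [||q [c [cq cc ->]]] :=
  codim_mid (homog_pair_subsp _ _ _) (DD_homog_subsp j) (M1_homog_subsp j) _ _ ce.
- by move=> g [].
- by move=> g [/M1_DD].
exists c => //; congr (_ + _)%N.
have [q' cq' E] := gbasis_codim j (D2_submod v J) Bth hth1 hth2.
have -> : q = q'.
  by apply: codim_uniq (homog_pair_subsp _ _ _) (DD_homog_subsp j) _ cq cq' => g [].
by rewrite /plane_codim; lia.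
Qed.

Lemma D_dim_sum N b :
  codim (@homog_pair K 3 N) (fun g => D g /\ homog_pair N g) b ->
  exists c : nat -> nat, [/\ forall j, (j <= N)%N ->
    codim (fun g => DD g /\ homog_pair j g) (fun g => M1 g /\ homog_pair j g) (c j) &
    b = (\sum_(j < N.+1) (plane_codim j + c j))%N].
Proof.
elim: N b => [|N IH] b.
  move/D_dim0/M1_dim_split => [c cc ->]; exists (fun=> c); split=> [j|].
    by rewrite leqn0 => /eqP ->.
  by rewrite big_ord1.
case/D_dim_step => b' [e [/IH [c [cc ->]] /M1_dim_split [c' cc' ->] ->]].
exists (fun j => if (j <= N)%N then c j else c'); split=> [j jN|].
  case: leqP => [|jN']; first exact: cc.
  by have -> : j = N.+1 by apply/eqP; rewrite eqn_leq jN.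
rewrite [RHS]big_ord_recr /= ltnn addnC; congr (_ + _)%N.
by apply: eq_bigr => j _; rewrite -ltnS ltn_ord.
Qed.

(** From degree j - 1 to j the codimension of D_H grows by n - 1 = d2 + d3, which is already the
    codimension of D(A^H, k) in degree j. Nothing is left for the quotient by M^1. *)
Lemma M1_full j g : (n < j)%N -> DD g -> homog_pair j g -> M1 g.
Proof.
case: j => // N nN Dg hg.
have [c1 cc1 E1] := D_dim (ltnW nN).
have [c0 cc0 E0] := D_dim nN.
have [b [e [cb ce E]]] := D_dim_step cc1.
have bc : b = c0.
  by apply: codim_uniq (homog_pair_subsp _ _ _) (D_homog_subsp N) _ cb cc0 => G [].
have [c cc Ec] := M1_dim_split ce.
have c00 : c = 0%N.
  have sm := degree_sum; have m2 : minn N.+2 d2 = d2 by lia.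
  have m3 : minn N.+2 d3 = d3 by lia.
  move: E1; rewrite E bc Ec /plane_codim m2 m3 sm; move: E0.
  by set x := (\sum_l _)%N; set y := (n.-1 ^ 2)%N; nia.
by move: cc; rewrite c00 => /codim0P /(_ g (conj Dg hg)) [].
Qed.

(** The sum falls short of d N by the triangular number d (d - 1) / 2, lost in the first d terms. *)
Lemma sum_minn d N : (d <= N)%N ->
  (2 * \sum_(j < N) minn j.+1 d + d * d = 2 * d * N + d)%N.
Proof.
elim: N => [|N IH]; first by rewrite leqn0 => /eqP ->; rewrite big_ord0.
rewrite leq_eqVlt => /predU1P [->|]; last first.
  rewrite ltnS => dN; rewrite big_ord_recr /= (minn_idPr (leqW dN)).
  by have := IH dN; set x := (\sum_(i < N) _)%N; rewrite mulnDr [(2 * d * N.+1)%N]mulnS; lia.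
rewrite (eq_bigr (fun j : 'I_N.+1 => j.+1)) => [|j _]; last by apply/minn_idPl.
elim: N {IH} => [|N IH]; first by rewrite big_ord1.
by rewrite big_ord_recr /=; move: IH; set x := (\sum_(i < _) _)%N; nia.
Qed.

(** The quotient is assembled from its graded pieces by the filtration [W k]: elements whose
    components of degree at least k lie in M^1. It runs from M^1 at k = 0 to all of D(A^H, k) at k =
    n + 1, and each step has the codimension found in degree k. *)
Lemma M1_codim : exists d : nat, codim DD M1 d /\
  (d + d2 * d3 = \sum_l #|cl a l @: [set j : 'I_n | [&& (j < l)%N, j != h & h \notin cl a l j]]|)%N.
Proof.
have [b cb Eb] := D_dim (leqnn n).
have [c [cc bE]] := D_dim_sum cb.
exists (\sum_(j < n.+1) c j)%N; split; last first.
  move: Eb; rewrite bE big_split /= /plane_codim big_split /=.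
  have := sum_minn (_ : (d2 <= n.+1)%N); have := sum_minn (_ : (d3 <= n.+1)%N).
  have sm := degree_sum; rewrite -sm.
  have n0 : (0 < n)%N by case: n h => // -[].
  move=> /(_ ltac:(lia)) s3 /(_ ltac:(lia)) s2; move: s2 s3.
  set x := (\sum_(j < _) minn _ d2)%N; set y := (\sum_(j < _) minn _ d3)%N.
  by rewrite -!mulnn; nia.
pose W k g := DD g /\ forall j, (k <= j)%N -> M1 (pipair j g).
have pipD j c' (g g' : S2 * S2) : pipair j (c' *: g + g') = c' *: pipair j g + pipair j g'.
  by congr pair; rewrite /= linearP.
have sW k : subsp (W k).
  split=> [|c' g g' [Dg Hg] [Dg' Hg']].
    split=> [|j _]; first by case: DD_subsp.
    by apply: M1_pipair; case: M1_subsp.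
  split=> [|j kj]; first exact: (proj2 DD_subsp).
  by rewrite pipD; apply: (proj2 M1_subsp); auto.
have W0 g : W 0%N g <-> M1 g.
  split=> [[_ H]|Mg]; last by split=> [|j _]; [apply: M1_DD | apply: M1_pipair].
  pose m := maxn (mmeasure mdeg g.1) (mmeasure mdeg g.2).
  have -> : g = \sum_(j < m) pipair j g.
    have E1 := pihomog_partitionE (leq_maxl (mmeasure mdeg g.1) (mmeasure mdeg g.2)).
    have E2 := pihomog_partitionE (leq_maxr (mmeasure mdeg g.1) (mmeasure mdeg g.2)).
    rewrite -/m in E1 E2.
    have -> : \sum_(j < m) pipair j g =
       (\sum_(j < m) pihomog mdeg j g.1, \sum_(j < m) pihomog mdeg j g.2).
      by elim/big_rec3: _ => [//|i x y z _ ->].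
    by rewrite -E1 -E2; case: (g).
  by apply: subsp_sum => [|j _]; [apply: M1_subsp | apply: H].
have Wn g : W n.+1 g <-> DD g.
  split=> [[]//|Dg]; split=> // j nj; apply: M1_full nj _ (pipair_homog _ _).
  exact: DD_pipair.
have pi0 j k (g : S2 * S2) : homog_pair j g -> j != k -> pipair k g = 0.
  by case=> h1 h2 jk; congr pair; apply: pihomog_ne0 jk _.
have step k : (k <= n)%N -> codim (W k.+1) (W k) (c k).
  move=> kn; apply: (codim_rel (R := fun d g => W k (g - d))) (cc k kn).
  - exact: DD_homog_subsp.
  - exact: sW.
  - by rewrite subr0; case: (sW k).
  - move=> c' x y x' y' H H'.
    rewrite (_ : _ - _ = c' *: (x' - x) + (y' - y)); first exact: (proj2 (sW k)).
    by rewrite scalerBr opprD addrACA.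
  - move=> d [Dd hd]; exists d; rewrite subrr; split; last by case: (sW k).
    split=> // j kj; rewrite (pi0 _ _ _ hd); first by case: M1_subsp.
    by rewrite neq_ltn kj.
  - move=> g [Dg Hg]; exists (pipair k g); split.
      by split; [apply: DD_pipair | apply: pipair_homog].
    split; first by apply: (subspB DD_subsp) => //; apply: DD_pipair.
    move=> j; rewrite leq_eqVlt => /predU1P [<-|kj].
      rewrite (_ : pipair k _ = 0); first by case: M1_subsp.
      by congr pair; rewrite /= pihomogB pihomog_id subrr.
    rewrite (_ : pipair j _ = pipair j g); first exact: Hg.
    have p0 : pipair j (pipair k g) = 0 by apply: pi0 (pipair_homog _ _) _; rewrite neq_ltn kj.
    by congr pair; rewrite /= pihomogB; [have := congr1 fst p0 | have := congr1 snd p0]; rewrite /= => ->; rewrite subr0.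
  - move=> d g [Dd hd] Wg Wgd; have := subspBK (sW k) Wgd.
    have : W k d <-> M1 d.
      have dE : pipair k d = d by case: (d) hd => x y [? ?]; congr pair; apply: pihomog_dE.
      split=> [[_ /(_ k (leqnn k))]|Md]; first by rewrite dE.
      by split=> // j _; apply: M1_pipair.
    by tauto.
have H k : (k <= n.+1)%N -> codim (W k) M1 (\sum_(j < k) c j).
  elim: k => [|k IH] kn; first by rewrite big_ord0; apply: codim_self => g /W0.
  rewrite big_ord_recr /= addnC; apply: codim_trans (step k _) (IH _) => //.
  - exact: M1_subsp.
  - by move=> g [Dg Hg]; split=> // j kj; apply: Hg; apply: ltnW.
  - by move=> g Mg; split=> [|j _]; [apply: M1_DD | apply: M1_pipair].
  - exact: ltnW.
by apply: codim_ext (H n.+1 (leqnn _)) => // g; apply: Wn.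
Qed.

End Basis.

End Main.

(** * From differential forms given as row vectors to derivations given as pairs *)

Section Dictionary.
Variables (K : fieldType) (n : nat) (A : 'M[K]_(n, 3)) (h : 'I_n).
Hypothesis arrA : arrangement A.
Hypothesis rowh : row h A = delta_mx 0 0.
Local Notation S3 := {mpoly K[3]}.
Local Notation S2 := {mpoly K[2]}.
Local Notation a := (fun i : 'I_n => row i A).
Local Notation v := (fun i : 'I_n => resvec (row i A)).
Local Notation J := [set~ h].
Local Notation DD := (D2 v J).
Local Notation D := (D3 a J).

Let i01 (i : 'I_2) : i = 0 \/ i = 1.
Proof. by case: i => [[|[|]]] // hi; [left | right]; apply: val_inj. Qed.

Lemma kmultE i : kmult A h i = multJ v J i.
Proof. by apply: eq_card => j; rewrite !inE andbA. Qed.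

Definition topair (R : Type) (g : 'rV[R]_2) : R * R := (g 0 0, g 0 1).
Definition ofpair (R : Type) (g : R * R) : 'rV[R]_2 :=
  \row_(j < 2) (if j == 0 then g.1 else g.2).

Lemma ofpairK (R : Type) (g : R * R) : topair (ofpair g) = g.
Proof. by case: g => x y; rewrite /topair !mxE. Qed.

Lemma topairK (R : Type) (g : 'rV[R]_2) : ofpair (topair g) = g.
Proof. by apply/rowP => j; rewrite mxE /=; case: (i01 j) => ->. Qed.

Lemma topair_lin (f1 f2 : S2) (g1 g2 : 'rV[S2]_2) :
  topair (f1 *: g1 + f2 *: g2) = pscal f1 (topair g1) + pscal f2 (topair g2).
Proof. by rewrite /topair !mxE. Qed.

Lemma topair0 : topair (0 : 'rV[S2]_2) = 0.
Proof. by rewrite /topair !mxE. Qed.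

Lemma topair_inj (R : Type) : injective (@topair R).
Proof. by move=> g g' E; rewrite -(topairK g) E topairK. Qed.

Lemma act_topair (u : 'rV[K]_2) (g : 'rV[S2]_2) :
  \sum_(j < 2) (u 0 j)%:MP * g 0 j = act u (topair g).
Proof.
rewrite /act !big_ord_recl big_ord0 addr0 !mul_mpolyC /=.
by congr (_ + u 0 _ *: g 0 _); apply: val_inj.
Qed.

Lemma DH_D2 g : DH A h g <-> DD (topair g).
Proof.
split=> H i.
  by rewrite !inE => ih; have := H i ih; rewrite act_topair kmultE.
by move=> ih; rewrite act_topair kmultE; apply: H; rewrite !inE.
Qed.

Lemma sum_ord2 (V : zmodType) (F : 'I_2 -> V) : \sum_(l < 2) F l = F ord0 + F ord_max.
Proof. by rewrite big_ord_recl big_ord1; congr (_ + F _); apply: val_inj. Qed.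

Lemma DH_basisP th : DH_basis A h th <->
  gbasis DD (topair (th ord0)) (topair (th ord_max)).
Proof.
split=> [[Dth [sp fr]]|[D1 D2 sp fr]].
  split; [exact/DH_D2 | exact/DH_D2 | |].
    move=> g Dg; have [|f E] := sp (ofpair g); first by apply/DH_D2; rewrite ofpairK.
    rewrite sum_ord2 in E; exists (f ord0), (f ord_max).
    by rewrite -topair_lin -E ofpairK.
  move=> f1 f2 E; pose f (l : 'I_2) := if l == ord0 then f1 else f2.
  have H : \sum_(l < 2) f l *: th l = 0.
    by apply: topair_inj; rewrite sum_ord2 topair_lin topair0.
  by split; [exact: (fr f H ord0) | exact: (fr f H ord_max)].
have oE (l : 'I_2) : l = ord0 \/ l = ord_max.
  by case: (i01 l) => ->; [left | right]; apply: val_inj.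
split; first by move=> l; apply/DH_D2; case: (oE l) => ->.
split=> [g /DH_D2 /sp [f1 [f2 E]]|f H l].
  exists (fun l => if l == ord0 then f1 else f2).
  by apply: topair_inj; rewrite sum_ord2 topair_lin.
have [E1 E2] : f ord0 = 0 /\ f ord_max = 0.
  by rewrite sum_ord2 in H; apply: fr; rewrite -topair_lin H topair0.
by case: (oE l) => ->.
Qed.

Lemma multiexponentsP d2 d3 : multiexponents A h d2 d3 <->
  exists th1 th2, [/\ gbasis DD th1 th2, homog_pair d2 th1 & homog_pair d3 th2].
Proof.
split=> [[th [/DH_basisP B [h1 h2]]]|[th1 [th2 [B [h1 h1'] [h2 h2']]]]].
  by exists (topair (th ord0)), (topair (th ord_max)); split; [|split; apply: h1|split; apply: h2].
exists (fun l => ofpair (if l == ord0 then th1 else th2)); split.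
  by apply/DH_basisP; rewrite /= !ofpairK.
by split=> j; rewrite mxE /=; case: ifP.
Qed.

Definition rot (q : 'rV[S2]_2) : S2 * S2 := (q 0 1, - q 0 0).
Definition unrot (g : S2 * S2) : 'rV[S2]_2 := ofpair (- g.2, g.1).

Lemma unrotK g : rot (unrot g) = g.
Proof. by case: g => x y; rewrite /rot !mxE /= opprK. Qed.

Lemma OmegaH_D2 q : OmegaH A h q <-> DD (rot q).
Proof.
have actE (u : 'rV[K]_2) : act u (rot q) = (u 0 0)%:MP * q 0 1 - (u 0 1)%:MP * q 0 0.
  by rewrite /act /= scalerN !mul_mpolyC.
split=> H i.
  by rewrite !inE => ih; rewrite actE -kmultE; apply: H.
move=> ih j k; have : i \in J by rewrite !inE.
move/H; rewrite actE -kmultE => H'.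
case: (i01 j) => ->; case: (i01 k) => ->; rewrite ?subrr //; try exact: pdvd0.
by rewrite -opprB -scaleN1r; apply: pdvdZ.
Qed.

(** The coefficient of dz2 and dz3 in the wedge product is z1 times the value of the rotated field,
    and z1 cancels modulo every line but H. In the other direction a dz1-component has to be
    found. *)
Lemma InM_M1 q : InM A q <-> M1 A h (rot q).
Proof.
have a0 i : row i A != 0 by apply: (proj1 arrA).
have i3 (i : 'I_3) : [\/ i = ord0, i = lift ord0 0 | i = lift ord0 1].
  case: i => [[|[|[|]]]] // hi; [apply: Or31 | apply: Or32 | apply: Or33]; exact: val_inj.
split=> [[p [Op [r [pr qE]]]]|[[G1 G2] DG qE]].
  exists (r 0 1, - r 0 0); last by rewrite qE /rot /rho2 /= !mxE /rho raddfN.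
  move=> i iJ; have := Op i (lift ord0 0) (lift ord0 1); rewrite !pr.
  rewrite (_ : _ - _ = 'X_ord0 * act (resvec (row i A)) (r 0 1, - r 0 0)); last first.
    by rewrite /act /= !mxE scalerN -!mul_mpolyC; ring.
  by case/(lf_prime (a0 i)) => // /(lf_ndvd_X0 arrA rowh iJ).
pose r : 'rV[S3]_2 := ofpair (- G2, G1).
have r0 : r 0 0 = - G2 by rewrite mxE.
have r1 : r 0 1 = G1 by rewrite mxE.
(* The dz1-component is chosen so that contraction with the Euler field, z1 p_1 + z2 p_2 + z3 p_3,
   vanishes. The two remaining wedge coefficients are then divisible as well. *)
pose p : 'rV[S3]_3 := \row_j (match unlift ord0 j with Some k => 'X_ord0 * r 0 k
  | None => - ('X_(lift ord0 0) * r 0 0 + 'X_(lift ord0 1) * r 0 1) end).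
have p0 : p 0 ord0 = - ('X_(lift ord0 0) * r 0 0 + 'X_(lift ord0 1) * r 0 1).
  by rewrite mxE unlift_none.
have pl k : p 0 (lift ord0 k) = 'X_ord0 * r 0 k by rewrite mxE liftK.
exists p; split; last first.
  exists r; split=> //; apply/rowP => j; rewrite !mxE; move: qE; rewrite /rot /rho2 /= => -[q1 q0].
  case: (i01 j) => -> /=; last by [].
  by rewrite /rho raddfN /=; rewrite /rho in q0; rewrite -q0 opprK.
move=> i.
have [t tE] : pdvd (lf (row i A)) ((A i (lift ord0 0))%:MP * G1 + (A i (lift ord0 1))%:MP * G2).
  have [->|ih] := eqVneq i h.
    have E k : A h (lift ord0 k) = 0.
      by have := congr1 (fun M : 'rV_3 => M 0 (lift ord0 k)) rowh; rewrite !mxE.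
    by rewrite !E !mpolyC0 !mul0r addr0; apply: pdvd0.
  have iJ : i \in J by rewrite !inE.
  by have := DG i iJ; rewrite /act /= !mxE -!mul_mpolyC.
have lE : linform (row i A) = (A i ord0)%:MP * 'X_ord0 +
    ((A i (lift ord0 0))%:MP * 'X_(lift ord0 0) + (A i (lift ord0 1))%:MP * 'X_(lift ord0 1)).
  rewrite /linform !big_ord_recl big_ord0 addr0 !mxE !mul_mpolyC.
  by congr (_ + (A i _ *: 'X_ _ + A i _ *: 'X_ _)); apply: val_inj.
have tE' : (A i (lift ord0 0))%:MP * G1 + (A i (lift ord0 1))%:MP * G2 = linform (row i A) * t by [].
have c01 : pdvd (linform (row i A)) ((A i ord0)%:MP * p 0 (lift ord0 0) - (A i (lift ord0 0))%:MP * p 0 ord0).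
  exists (r 0 0 + 'X_(lift ord0 1) * t); rewrite mulrDr mulrCA -tE' lE p0 pl r0 r1; ring.
have c02 : pdvd (linform (row i A)) ((A i ord0)%:MP * p 0 (lift ord0 1) - (A i (lift ord0 1))%:MP * p 0 ord0).
  exists (r 0 1 - 'X_(lift ord0 0) * t); rewrite mulrBr [_ * ('X_ _ * t)]mulrCA -tE' lE p0 pl r0 r1; ring.
have c12 : pdvd (linform (row i A)) ((A i (lift ord0 0))%:MP * p 0 (lift ord0 1) - (A i (lift ord0 1))%:MP * p 0 (lift ord0 0)).
  exists ('X_ord0 * t); rewrite mulrCA -tE' !pl r0 r1; ring.
have neg x y : pdvd (linform (row i A)) (x - y) -> pdvd (linform (row i A)) (y - x).
  by move=> H; rewrite -opprB -scaleN1r; apply: pdvdZ.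
move=> j k; case: (i3 j) => ->; case: (i3 k) => ->; rewrite ?subrr //;
  try exact: pdvd0; exact: neg.
Qed.

Lemma codim_quot_dim d : codim DD (M1 A h) d -> quot_dim A h d.
Proof.
case=> w [Dw sp fr]; exists (fun l => unrot (w l)).
have E (c : 'I_d -> K) : rot (\sum_l (c l)%:MP *: unrot (w l)) = lincomb w (\row_l c l).
  rewrite /lincomb; elim/big_rec2: _ => [|l g q _ IH].
    by rewrite /rot !mxE oppr0.
  rewrite -IH /rot !mxE /= opprD mulrN opprK !mul_mpolyC.
  by case: (w l) => x y.
have rotB q q' : rot (q - q') = rot q - rot q'.
  by rewrite /rot !mxE opprD.
split; first by move=> l; apply/OmegaH_D2; rewrite unrotK.
split=> [q /OmegaH_D2 /sp [c Hc]|c /InM_M1].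
  exists (fun l => c 0 l); apply/InM_M1; rewrite rotB E.
  by rewrite (_ : \row_l c 0 l = c) //; apply/rowP => l; rewrite mxE.
rewrite E => /fr c0 l; have := congr1 (fun M : 'rV_d => M 0 l) c0.
by rewrite !mxE.
Qed.

End Dictionary.

Theorem mainTheorem3 (K : fieldType) (n : nat) (A : 'M[K]_(n, 3)) (h : 'I_n) :
  [pchar K] =i pred0 ->
  arrangement A ->
  row h A = delta_mx 0 0 ->
  (exists d2 d3 : nat, multiexponents A h d2 d3) /\
  (forall d2 d3 : nat, multiexponents A h d2 d3 ->
     exists d : nat, quot_dim A h d /\
       d%:Z = (charpoly0 A).[0] - (d2 * d3)%:Z).
Proof.
move=> _ arrA rowh; have [a0 an] := arrA; split.
  have [|d2 [d3 [th1 [th2 [B h1 h2 _]]]]] :=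
      @D2_basis K _ (fun i => resvec (row i A)) [set~ h].
    by move=> j; rewrite !inE; apply: (@re_neq0 _ _ (fun i => row i A) h).
  by exists d2, d3; apply/multiexponentsP; exists th1, th2.
move=> d2 d3 /multiexponentsP [th1 [th2 [B h1 h2]]].
have [d [cd E]] := M1_codim arrA rowh B h1 h2.
exists d; split; first exact: (codim_quot_dim arrA rowh cd).
rewrite (charpoly0E h arrA) (b2E h arrA) -E natz PoszD.
by rewrite addrK.
Qed.
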